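(* Let $\mathcal{L}\in\mathscr{X}_{k,d,n}$ be a $k$-dimensional linear system of hypersurfaces of degree $d$ in $\mathbb{P}^n$. Then $\mathcal{L}$ is GIT stable (resp. GIT semistable) if and only if for any choice of generators $H_1,\ldots,H_{k+1}\in\mathcal{L}$ the hypersurface $H_1+\cdots+H_{k+1}$ of degree $d(k+1)$ is GIT stable (resp. GIT semistable).
   Context: We work over $\mathbb{C}$. Let $S_d$ be the vector space of homogeneous polynomials of degree $d$ in $x_0,\ldots,x_n$. A hypersurface of degree $d$ in $\mathbb{P}^n$ (possibly reducible or non-reduced) is an effective divisor $H_f=(f=0)$ with $0\neq f\in S_d$; thus $H_f+H_g=H_{fg}$. A $k$-dimensional linear system of hypersurfaces of degree $d$ is a $(k+1)$-dimensional linear subspace $\mathcal{L}\subset S_d$; $H_f\in\mathcal{L}$ means $f\in\mathcal{L}$, and generators of $\mathcal{L}$ are hypersurfaces $H_{f_1},\ldots,H_{f_{k+1}}$ with $f_1,\ldots,f_{k+1}$ a basis of $\mathcal{L}$. The space $\mathscr{X}_{k,d,n}$ of all such linear systems is the Grassmannian of $(k+1)$-dimensional subspaces of $S_d$, embedded in $\mathbb{P}(\Lambda^{k+1}S_d)$ by Plücker coordinates. The group $SL_{n+1}(\mathbb{C})$ acts by linear changes of coordinates on each $S_e$ and on $\Lambda^{k+1}S_d$. For a point $[v]\in\mathbb{P}(W)$ with $W$ one of these representations: $[v]$ is GIT semistable if $0\notin\overline{SL_{n+1}\cdot v}$, GIT unstable otherwise, GIT stable if it is semistable, $SL_{n+1}\cdot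 v$ is closed in $W$ and $v$ has finite stabilizer, and non-stable if it is not stable. A hypersurface $H_f$ of degree $e$ is called GIT (semi)stable if $[f]\in\mathbb{P}(S_e)$ is, and a linear system $\mathcal{L}$ is called GIT (semi)stable if its Plücker point in $\mathbb{P}(\Lambda^{k+1}S_d)$ is. *)

(* Defs.v *)
From HB Require Import structures.
From mathcomp Require Import all_boot all_order all_algebra.
From mathcomp Require Import all_classical all_reals all_analysis.
(* The notations of mpoly clash with those of mathcomp-analysis. *)
From mathcomp.multinomials Require Import -(notations) mpoly.
Import numFieldNormedType.Exports.

Set Implicit Arguments.
Unset Strict Implicit.
Unset Printing Implicit Defensive.

Import GRing.Theory.
Local Open Scope classical_set_scope.
Local Open Scope ring_scope.

Section Coordinates.
Variables (K : fieldType) (V : vectType K).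

Definition coords (v : V) : 'rV[K]_(\dim {:V}) :=
  \row_j coord (vbasis {:V}) j v.

End Coordinates.

(* GIT stability of the vector v, for an action [act] of SL_N(K) on a
   finite-dimensional vector space W.  The closure in W is transported from
   row vectors along [coords]; for K = R[i] this is the closure for the
   Euclidean topology, whatever the basis. *)
Section GIT.
Variables (K : numFieldType) (N : nat) (W : vectType K).
Variable act : 'M[K]_N -> W -> W.

Definition SL : set 'M[K]_N := [set g | \det g = 1].

Definition orbit (v : W) : set W := [set act g v | g in SL].

Definition stabilizer (v : W) : set 'M[K]_N := [set g | SL g /\ act g v = v].

Definition vclosure (A : set W) : set W :=
  @coords K W @^-1` closure (@coords K W @` A).

Definition git_semistable (v : W) : Prop := ~ vclosure (orbit v) 0.

Definition git_stable (v : W) : Prop :=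
  [/\ git_semistable v, vclosure (orbit v) = orbit v
    & finite_set (stabilizer v)].

End GIT.

(* The m-th exterior power of V, with basis the e_(s_0) ^ ... ^ e_(s_(m-1))
   for s_0 < ... < s_(m-1), where e := vbasis {:V}. *)
Section ExteriorPower.
Variables (K : fieldType) (V : vectType K) (m : nat).

Definition incr_index : Type :=
  {s : m.-tuple 'I_(\dim {:V}) | sorted ltn [seq val i | i <- s]}.

HB.instance Definition _ := Finite.on incr_index.

Definition extpow : Type := {ffun incr_index -> K^o}.

HB.instance Definition _ := Vector.on extpow.

Definition wedge (f : 'I_m -> V) : extpow :=
  [ffun s : incr_index =>
     \det (\matrix_(i < m, j < m) coords (f i) 0 (tnth (val s) j))].

(* The map induced by A, for A linear. *)
Definition ext_map (A : V -> V) (p : extpow) : extpow :=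
  \sum_(s : incr_index)
    p s *: wedge (fun i => A (vbasis {:V})`_(tnth (val s) i)).

(* Spans the line of \Lambda^m V attached to L when \dim L = m. *)
Definition plucker (L : {vspace V}) : extpow :=
  wedge (fun i => (vbasis L)`_i).

End ExteriorPower.

Section Hypersurfaces.
Variables (K : numFieldType) (n : nat).

(* With x = (x_0, ..., x_n) a row vector, [lin_form g j] is the j-th entry of
   x g and [lin_subst g f] is f(x g); this is a left action.  It differs from
   f |-> f(g^-1 x) by the automorphism g |-> (g^-1)^T of SL. *)
Definition lin_form (g : 'M[K]_n.+1) (j : 'I_n.+1) : mpoly n.+1 K :=
  \sum_i g i j *: mpolyX K (mnm1 i).

Definition lin_subst (g : 'M[K]_n.+1) (f : mpoly n.+1 K) : mpoly n.+1 K :=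
  comp_mpoly [tuple lin_form g j | j < n.+1] f.

Lemma prod_homog m (I : finType) (d : I -> nat) (F : I -> mpoly n.+1 K) :
    (forall i, F i \is ishomog1 (d i) mdeg) -> m = (\sum_i d i)%N ->
  \prod_i F i \is ishomog1 m mdeg.
Proof.
move=> hF ->; elim/big_ind2: _ => [|p a q b hp hq|i _]; last exact: hF.
- exact: dhomog1.
- exact: dhomogM.
Qed.

Lemma lin_subst_homog d g (f : dhomog n.+1 K d) :
  lin_subst g (val f) \is ishomog1 d mdeg.
Proof.
rewrite /lin_subst comp_mpolyE big_seq; apply: rpred_sum => m mf.
apply: rpredZ; apply: (@prod_homog _ _ (fun i => m i)) => [i|].
  rewrite -[X in ishomog1 X]mul1n; apply: dhomogMn; rewrite tnth_mktuple.
  by apply: rpred_sum => k _; apply: rpredZ; rewrite dhomogX /= mdeg1.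
by rewrite -(dhomog_mf (dhomog_is_dhomog f) mf) /= mdegE.
Qed.

Definition hs_act d (g : 'M[K]_n.+1) (f : dhomog n.+1 K d) : dhomog n.+1 K d :=
  DHomog (lin_subst_homog g f).

Lemma hs_sum_homog d m (F : 'I_m -> dhomog n.+1 K d) :
  \prod_i val (F i) \is ishomog1 (d * m)%N mdeg.
Proof.
apply: (@prod_homog _ _ (fun=> d)) => [i|]; first exact: dhomog_is_dhomog.
by rewrite sum_nat_const card_ord mulnC.
Qed.

(* The equation of the divisor H_(F 0) + ... + H_(F (m-1)). *)
Definition hs_sum d m (F : 'I_m -> dhomog n.+1 K d) : dhomog n.+1 K (d * m) :=
  DHomog (hs_sum_homog F).

Definition hs_semistable d (f : dhomog n.+1 K d) : Prop :=
  git_semistable (@hs_act d) f.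

Definition hs_stable d (f : dhomog n.+1 K d) : Prop :=
  git_stable (@hs_act d) f.

Definition linsys_act d m (g : 'M[K]_n.+1) :
    extpow (dhomog n.+1 K d) m -> extpow (dhomog n.+1 K d) m :=
  ext_map (hs_act g).

Definition linsys_semistable d k (L : {vspace dhomog n.+1 K d}) : Prop :=
  git_semistable (@linsys_act d k.+1) (plucker k.+1 L).

Definition linsys_stable d k (L : {vspace dhomog n.+1 K d}) : Prop :=
  git_stable (@linsys_act d k.+1) (plucker k.+1 L).

End Hypersurfaces.

(* Main.v *)
From HB Require Import structures.
From mathcomp Require Import all_boot all_order all_algebra.
From mathcomp Require Import all_classical all_reals all_analysis.
From mathcomp Require Import fingroup perm complex lra.
From mathcomp.multinomials Require Import -(notations) mpoly.
Require Import Defs.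
Import numFieldNormedType.Exports.
Set Implicit Arguments.
Unset Strict Implicit.
Unset Printing Implicit Defensive.
Import Normc.
Import Order.TTheory GRing.Theory Num.Theory.
Local Open Scope classical_set_scope.
Local Open Scope ring_scope.
Local Open Scope complex_scope.

(** A numerical criterion governs both sides of the equivalence.  For h in
    SL_N(C) and a real vector lam with entries of sum zero, say that (h, lam)
    destabilizes a vector v when every torus weight occurring in h v pairs
    positively with lam, and destabilizes it weakly when lam is nonzero and
    these pairings are nonnegative.  Then v is semistable if and only if no
    pair destabilizes it ([hilbert_mumford_semistable]), and a nonzero v is
    stable if and only if no pair destabilizes it weakly
    ([hilbert_mumford_stable]).

    For a fixed pair (h, lam) the theorem becomes a comparison of weights
    ([plucker_weights]).  The Pluecker coordinates of h L are the maximal minors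
    of the coefficient matrix of a basis of h L.  For a basis F of L, the least
    weight of the product of the h F_i is the sum of the least weights of the
    factors, because the initial forms of the factors have a nonzero product;
    and a nonzero minor involves one monomial of each h F_i, so it weighs at
    least that sum ([sum_wt_wedge_wt]).  Conversely, take a nonzero minor of
    least weight and put the basis in echelon form at its columns: minimality
    forces each monomial of the i-th polynomial to weigh at least as much as
    the i-th pivot, so each monomial of the product weighs at least as much as
    the minor ([echelon_basis], [wedge_wt_sum_wt]).  Hence a pair destabilizes
    L if and only if it destabilizes the product of some basis of L, weakly or
    not.

    The criterion is proved by analysis.  Write g = k t h with k and h unitary
    and t = exp(mu) positive diagonal, and take limits along an ultrafilter,
    where every bounded sequence converges ([cartan_limit]).  If g_j v tends to
    0, then so does t_j h_j v; when h_j tends to h, all the weights of h v pair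
    negatively with mu_j for j large, so that - mu_j destabilizes
    ([unstable_destabilized]).  If g_j v stays bounded while g_j does not, the
    normalized mu_j have a nonzero limit that pairs nonpositively with the
    weights of h v ([properI]).  So if nothing destabilizes v weakly, the map
    sending g to g v is proper on SL_N(C): the orbit is closed
    ([orbit_closed]) and the stabilizer is bounded.  A bounded stabilizer is
    finite ([finite_stabilizer]): an infinite one contains elements g <> 1
    arbitrarily close to 1, and, having bounded powers, such a g is
    diagonalizable with eigenvalues exp(i theta_j).  For small theta the
    equations exp(i <theta, chi>) = 1 expressing that g fixes v say
    <theta, chi> = 0, so the unbounded real ray exp(s theta) fixes v as well.
    In the other direction, a destabilizing ray moves v to 0; a weakly
    destabilizing ray moves v to a vector that the ray fixes, and if the orbit
    is closed this makes the stabilizer of v infinite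
    ([weakly_destabilized_nonstable]). *)

(** * Limits of complex-valued functions *)

Section ComplexModulus.
Variable R : realType.
Local Notation C := R[i].

Lemma normc_Re (z : C) : `|complex.Re z| <= normc z.
Proof. by have := normc_ge_Re z; rewrite lecR. Qed.

Lemma normc_Im (z : C) : `|complex.Im z| <= normc z.
Proof.
by case: z => a b /=; rewrite -(sqrtr_sqr b) ler_sqrt ?addr_ge0 ?sqr_ge0// lerDr sqr_ge0.
Qed.

Lemma normc_le_ReIm (z : C) : normc z <= `|complex.Re z| + `|complex.Im z|.
Proof.
case: z => a b /=.
rewrite -[leRHS]ger0_norm ?addr_ge0// -sqrtr_sqr ler_sqrt ?sqr_ge0//.
have := normr_ge0 a; have := normr_ge0 b.
rewrite -(real_normK (num_real a)) -(real_normK (num_real b)).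
nra.
Qed.

Lemma normc_ge0 (z : C) : 0 <= normc z.
Proof. exact: le_trans (normc_Re z). Qed.

Lemma normc_gt0 (z : C) : (0 < normc z) = (z != 0).
Proof.
rewrite lt_neqAle normc_ge0 andbT eq_sym; congr (~~ _).
by apply/eqP/eqP => [/eq0_normc//|->]; exact: normc0.
Qed.

Lemma normc_real (x : R) : normc x%:C = `|x|.
Proof. by rewrite /= expr0n/= addr0 sqrtr_sqr. Qed.

Lemma normc_sum (J : Type) (r : seq J) (P : pred J) (F : J -> C) :
  normc (\sum_(j <- r | P j) F j) <= \sum_(j <- r | P j) normc (F j).
Proof.
elim/big_rec2: _ => [|j y x _ xy]; first by rewrite normc0.
by rewrite (le_trans (le_normcD _ _))// lerD2l.
Qed.

Lemma normc_mulmx_le m p (u : 'rV[C]_m) (M : 'M[C]_(m, p)) B :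
    (forall i j, normc (M i j) <= B) ->
  forall j, normc ((u *m M) 0 j) <= (\sum_i normc (u 0 i)) * B.
Proof.
move=> MB j; rewrite mxE mulr_suml (le_trans (normc_sum _ _ _))//.
by apply: ler_sum => i _; rewrite normcM ler_wpM2l ?normc_ge0.
Qed.

Lemma normcX (a : C) k : normc (a ^+ k) = normc a ^+ k.
Proof.
elim: k => [|k IH]; first by rewrite !expr0 normc1.
by rewrite !exprS normcM IH.
Qed.

End ComplexModulus.

Section ComplexLimits.
Variables (R : realType).
Local Notation C := R[i].
Local Notation Re := complex.Re.
Local Notation Im := complex.Im.

(** Convergence is tested on real and imaginary parts, so that the sum, product
    and compactness arguments are those of the real field. *)
Definition ctends (T : Type) (F : set_system T) (f : T -> C) (l : C) : Prop :=
  (Re (f x) @[x --> F] --> Re l) /\ (Im (f x) @[x --> F] --> Im l).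

Section Filter.
Variables (T : Type) (F : set_system T).
Context {FF : ProperFilter F}.
Implicit Types f g : T -> C.

Lemma ctends_cst l : ctends F (fun=> l) l.
Proof. by split => /=; apply: cvg_cst. Qed.

Lemma ctends_congr f g k l : f =1 g -> k = l -> ctends F g l -> ctends F f k.
Proof. by move=> /funext -> ->. Qed.

Lemma eq_ctends f g l : f =1 g -> ctends F f l -> ctends F g l.
Proof. by move=> /funext ->. Qed.

Lemma ctendsD f g k l :
  ctends F f k -> ctends F g l -> ctends F (fun x => f x + g x) (k + l).
Proof.
have ReD (x y : C) : Re (x + y) = Re x + Re y by case: x; case: y.
have ImD (x y : C) : Im (x + y) = Im x + Im y by case: x; case: y.
move=> [f1 f2] [g1 g2]; split.
  by under eq_fun do rewrite ReD; rewrite ReD; apply: cvgD.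
by under eq_fun do rewrite ImD; rewrite ImD; apply: cvgD.
Qed.

Lemma ctendsM f g k l :
  ctends F f k -> ctends F g l -> ctends F (fun x => f x * g x) (k * l).
Proof.
have ReM (x y : C) : Re (x * y) = Re x * Re y - Im x * Im y by case: x; case: y.
have ImM (x y : C) : Im (x * y) = Re x * Im y + Im x * Re y by case: x; case: y.
move=> [f1 f2] [g1 g2]; split.
  under eq_fun do rewrite ReM; rewrite ReM.
  by apply: cvgB; apply: cvgM.
under eq_fun do rewrite ImM; rewrite ImM.
by apply: cvgD; apply: cvgM.
Qed.

Lemma ctends_sum (I : Type) (r : seq I) (P : pred I) (f : I -> T -> C) l :
    (forall i, P i -> ctends F (f i) (l i)) ->
  ctends F (fun x => \sum_(i <- r | P i) f i x) (\sum_(i <- r | P i) l i).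
Proof.
move=> fl; elim: r => [|i r IH].
  by rewrite big_nil; apply: eq_ctends (ctends_cst 0) => x; rewrite big_nil.
rewrite big_cons; case: ifP => Pi.
  by apply: eq_ctends (ctendsD (fl i Pi) IH) => x; rewrite big_cons Pi.
by apply: eq_ctends IH => x; rewrite big_cons Pi.
Qed.

Lemma ctends_prod (I : Type) (r : seq I) (P : pred I) (f : I -> T -> C) l :
    (forall i, P i -> ctends F (f i) (l i)) ->
  ctends F (fun x => \prod_(i <- r | P i) f i x) (\prod_(i <- r | P i) l i).
Proof.
move=> fl; elim: r => [|i r IH].
  by rewrite big_nil; apply: eq_ctends (ctends_cst 1) => x; rewrite big_nil.
rewrite big_cons; case: ifP => Pi.
  by apply: eq_ctends (ctendsM (fl i Pi) IH) => x; rewrite big_cons Pi.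
by apply: eq_ctends IH => x; rewrite big_cons Pi.
Qed.

Lemma ctends_det n (f : T -> 'M[C]_n) (l : 'M[C]_n) :
    (forall i j, ctends F (fun x => f x i j) (l i j)) ->
  ctends F (fun x => \det (f x)) (\det l).
Proof.
move=> fl; apply: ctends_sum => s _.
by apply: ctendsM (ctends_cst _) _; apply: ctends_prod => i _.
Qed.

Lemma ctends_mulmx m n p (f : T -> 'M[C]_(m, n)) (g : T -> 'M[C]_(n, p))
    (k : 'M[C]_(m, n)) (l : 'M[C]_(n, p)) :
    (forall i j, ctends F (fun x => f x i j) (k i j)) ->
    (forall i j, ctends F (fun x => g x i j) (l i j)) ->
  forall i j, ctends F (fun x => (f x *m g x) i j) ((k *m l) i j).
Proof.
move=> fk gl i j; rewrite mxE.
by apply: eq_ctends (ctends_sum _ _) => [x|s _]; [rewrite mxE|exact: ctendsM].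
Qed.

Lemma ctends_unique f k l : ctends F f k -> ctends F f l -> k = l.
Proof.
case: k l => [a b] [c d] [/= f1 f2] [/= g1 g2].
by rewrite (cvg_unique _ f1 g1)// (cvg_unique _ f2 g2).
Qed.

Lemma ctends_real (f : T -> R) (l : R) :
  f x @[x --> F] --> l -> ctends F (fun x => (f x)%:C) l%:C.
Proof. by move=> fl; split => //=; exact: cvg_cst. Qed.

Lemma ctendsP f l :
  ctends F f l <-> forall e : R, 0 < e -> F [set x | normc (f x - l) < e].
Proof.
have ReB (x y : C) : Re (x - y) = Re x - Re y by case: x; case: y.
have ImB (x y : C) : Im (x - y) = Im x - Im y by case: x; case: y.
split=> [[/cvgrPdist_lt f1 /cvgrPdist_lt f2] e e0|fl].
  have e20 : 0 < e / 2 by rewrite divr_gt0.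
  apply: filterS2 (f1 _ e20) (f2 _ e20) => x /= h1 h2.
  apply: le_lt_trans (normc_le_ReIm _) _.
  by rewrite ReB ImB (distrC (Re (f x))) (distrC (Im (f x))) [ltRHS]splitr ltrD.
split; apply/cvgrPdist_lt => e e0; apply: filterS (fl e e0) => x /=.
  by apply: le_lt_trans; rewrite distrC -ReB normc_Re.
by apply: le_lt_trans; rewrite distrC -ImB normc_Im.
Qed.

Lemma ctends_lbound f l : l != 0 -> ctends F f l ->
  F [set x | normc l / 2 < normc (f x)].
Proof.
move=> l0 /ctendsP fl.
have nl : 0 < normc l by rewrite normc_gt0.
apply: filterS (fl _ (divr_gt0 nl (ltr0n _ 2))) => x /=.
have : normc l <= normc (f x) + normc (f x - l).
  have {1}-> : l = f x + - (f x - l) by rewrite opprB addrC subrK.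
  by apply: le_trans (le_normcD _ _) _; rewrite normcN.
by rewrite {2}[normc l]splitr; lra.
Qed.

Lemma ctends_ubound f l : ctends F f l -> F [set x | normc (f x) < normc l + 1].
Proof.
move=> /ctendsP fl; apply: filterS (fl 1 ltr01) => x /= h.
by rewrite -(subrK l (f x)) addrC (le_lt_trans (le_normcD _ _))// ltrD2l.
Qed.

Lemma ctends0P f : ctends F f 0 <-> forall e : R, 0 < e -> F [set x | normc (f x) < e].
Proof.
split=> [/ctendsP h e /h|h]; first by apply: filterS => x /=; rewrite subr0.
by apply/ctendsP => e /h; apply: filterS => x /=; rewrite subr0.
Qed.

End Filter.

Lemma ctends_filterS (T : Type) (F G : set_system T) f l :
  F `<=` G -> ctends F f l -> ctends G f l.
Proof. by move=> FG [f1 f2]; split => A /= ?; apply: FG; [apply: f1|apply: f2]. Qed.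

Section Ultra.
Variables (T : Type) (U : set_system T).
Context {UU : UltraFilter U}.

Lemma ultra_cvg (f : T -> R) (M : R) : U [set x | `|f x| <= M] ->
  exists l : R, f x @[x --> U] --> l.
Proof.
move=> fM.
have uf : UltraFilter (fmap f U).
  constructor; first exact: fmap_proper_filter.
  move=> G pG sub; apply/seteqP; split => [A GA|]; last exact: sub.
  have [//|nA] := in_ultra_setVsetC (f @^-1` A) UU.
  have GcA : G (~` A) by apply: sub.
  by have [x []] := filter_ex (filterI GA GcA).
have := @segment_compact R (- M) M; rewrite compact_ultra => /(_ _ uf) [].
  rewrite /fmap /=; apply: filterS fM => x /=.
  by rewrite in_itv/= -ler_norml.
by move=> l [_ /= fl]; exists l.
Qed.

(** Along an ultrafilter no subsequence has to be extracted: a bounded function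
    converges. *)
Lemma ultra_ctends (f : T -> C) (M : R) : U [set x | normc (f x) <= M] ->
  exists l, ctends U f l.
Proof.
move=> fM.
have [|a fa] := @ultra_cvg (fun x => Re (f x)) M.
  by apply: filterS fM => x; exact: le_trans (normc_Re _).
have [|b fb] := @ultra_cvg (fun x => Im (f x)) M.
  by apply: filterS fM => x; exact: le_trans (normc_Im _).
by exists (Complex a b).
Qed.

Lemma ultra_ctends_mx m n (f : T -> 'M[C]_(m, n)) (M : R) :
    U [set x | forall i j, normc (f x i j) <= M] ->
  exists l : 'M[C]_(m, n), forall i j, ctends U (fun x => f x i j) (l i j).
Proof.
move=> fM.
have /choice[h hP] : forall ij : 'I_m * 'I_n,
    exists l, ctends U (fun x => f x ij.1 ij.2) l.
  by move=> ij; apply: (@ultra_ctends _ M); apply: filterS fM => x; exact.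
by exists (\matrix_(i, j) h (i, j)) => i j; rewrite mxE; exact: hP (i, j).
Qed.

End Ultra.

Lemma ultra_oo : exists U : set_system nat, UltraFilter U /\ \oo `<=` U.
Proof. exact: ultraFilterLemma. Qed.

End ComplexLimits.

Lemma closure_rV (K : numFieldType) n (A : set 'rV[K]_n) (y : 'rV[K]_n) :
  closure A y <->
  forall e : K, 0 < e -> exists2 a, A a & forall j, `|y 0 j - a 0 j| < e.
Proof.
split=> [cA e e0|h B].
  have [a [Aa /= ya]] := cA _ (nbhsx_ballx y e e0).
  by exists a => // j; case: ya => _ /(_ 0 j); rewrite -ball_normE.
move=> /nbhs_ballP[e /= e0 eB]; have [a Aa ya] := h e e0.
by exists a; split => //; apply: eB; split => // i j; rewrite ord1 -ball_normE; exact: ya.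
Qed.

(** * Singular values *)

Section SingularValues.
Local Open Scope sesquilinear_scope.
Variables (C : numClosedFieldType) (N : nat).

Lemma unitary_det (k : 'M[C]_N) : k \is unitarymx -> `|\det k| = 1.
Proof.
move=> /unitarymxP/(congr1 determinant); rewrite det_mulmx det1 det_map_mx det_tr.
by rewrite -normCK => /eqP; rewrite pexpr_eq1// => /eqP.
Qed.

Lemma unitary_left_inverse (k : 'M[C]_N) : k \is unitarymx ->
  exists2 k', k' \is unitarymx & k' *m k = 1%:M.
Proof.
move=> ku; exists (invmx k); last by rewrite mulVmx ?unitarymx_unit.
by rewrite invmx_unitary// trmxC_unitary.
Qed.

Lemma polar_column (Q : 'M[C]_N) (d : 'rV[C]_N) :
  \det Q != 0 -> Q^t* *m Q = diag_mx d -> forall j, 0 < d 0 j.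
Proof.
move=> Q0 QQ j.
have dd : \prod_j d 0 j != 0.
  by rewrite -det_diag -QQ det_mulmx det_map_mx det_tr mulf_neq0// conjC_eq0.
rewrite lt_neqAle eq_sym; apply/andP; split.
  by apply: contra dd => /eqP dj; rewrite (bigD1 j)//= dj mul0r.
have := congr1 (fun M : 'M[C]_N => M j j) QQ; rewrite [RHS]mxE eqxx mulr1n => <-.
by rewrite mxE sumr_ge0// => i _; rewrite !mxE mulrC -normCK exprn_ge0.
Qed.

(** The Hermitian matrix g^* g has an orthonormal eigenbasis u; the columns of
    g u^* are then orthogonal, and dividing them by their norms t gives a
    unitary matrix. *)
Lemma svd (g : 'M[C]_N) : \det g != 0 ->
  exists k u : 'M[C]_N, exists t : 'rV[C]_N,
    [/\ k \is unitarymx, u \is unitarymx, forall j, 0 < t 0 j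
      & k *m g = diag_mx t *m u].
Proof.
move=> g0; pose A := g^t* *m g.
have An : A \is normalmx.
  by apply/normalmxP; rewrite trmx_mul map_mxM trmxCK.
pose U := spectralmx A; pose d := spectral_diag A.
have Uu : U \is unitarymx := spectral_unitarymx A.
have UU : U *m U^t* = 1%:M by apply/unitarymxP.
have UA : U *m A = diag_mx d *m U.
  have {1}-> : A = invmx U *m diag_mx d *m U := orthomx_spectralP An.
  by rewrite !mulmxA mulmxV ?mul1mx// unitarymx_unit.
pose Q := g *m U^t*.
have Qs : Q^t* = U *m g^t* by rewrite trmx_mul map_mxM trmxCK.
have QQ : Q^t* *m Q = diag_mx d.
  by rewrite Qs /Q mulmxA -(mulmxA U) UA -mulmxA UU mulmx1.
have Q0 : \det Q != 0.
  rewrite det_mulmx mulf_neq0// det_map_mx det_tr conjC_eq0.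
  by rewrite -normr_eq0 unitary_det// oner_eq0.
have d0 := polar_column Q0 QQ.
pose t : 'rV[C]_N := \row_j sqrtC (d 0 j).
have t0 j : 0 < t 0 j by rewrite mxE sqrtC_gt0.
pose ti : 'rV[C]_N := \row_j (t 0 j)^-1.
have tit : diag_mx ti *m diag_mx d = diag_mx t.
  rewrite mulmx_diag; congr diag_mx; apply/rowP => j; rewrite !mxE.
  by rewrite -{2}(sqrtCK (d 0 j)) expr2 mulKf// gt_eqF// sqrtC_gt0.
have tis : (diag_mx ti)^t* = diag_mx ti.
  apply/matrixP => i j; rewrite !mxE eq_sym; case: eqVneq => [->|_].
    by rewrite !mulr1n conj_Creal// realV gtr0_real// sqrtC_gt0.
  by rewrite !mulr0n rmorph0.
exists (diag_mx ti *m Q^t*), U, t; split=> //.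
  have ks : (diag_mx ti *m Q^t*)^t* = Q *m diag_mx ti.
    by rewrite trmx_mul map_mxM trmxCK tis.
  apply/unitarymxP; rewrite ks.
  rewrite mulmxA -(mulmxA _ _ Q) QQ tit mulmx_diag -diag_const_mx.
  congr diag_mx; apply/rowP => j; rewrite !mxE mulfV//.
  by have := t0 j; rewrite mxE => /gt_eqF ->.
by rewrite -mulmxA Qs -mulmxA -/A UA mulmxA tit.
Qed.

End SingularValues.

Section CartanDecomposition.
Variables (R : realType) (n : nat).
Local Notation C := R[i].
Local Notation N := n.+1.

Definition torus (lam : 'rV[R]_N) : 'M[C]_N :=
  diag_mx (\row_j (expR (lam 0 j))%:C).

Lemma det_torus lam : \det (torus lam) = (expR (\sum_j lam 0 j))%:C.
Proof.
rewrite det_diag expR_sum rmorph_prod; apply: eq_bigr => j _.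
by rewrite mxE.
Qed.

Lemma unitary_entry (m p : nat) (k : 'M[C]_(m, p)) i j :
  k \is unitarymx -> normc (k i j) <= 1.
Proof.
move=> /unitarymxP kk; rewrite -(@ler_pXn2r _ 2)// ?nnegrE ?normc_ge0// expr1n.
have := congr1 (fun M : 'M[C]_m => M i i) kk; rewrite !mxE eqxx => h.
rewrite -lecR rmorphXn/= -[1%:C]h (bigD1 j)//= !mxE -normCK.
by rewrite lerDl sumr_ge0// => l _; rewrite !mxE -normCK exprn_ge0.
Qed.

(** The determinant of t is positive and of modulus 1, hence 1.  The unitary
    factor h is brought into SL by a unitary diagonal matrix, which commutes
    with the torus and can be moved into k. *)
Lemma cartan_SL (g : 'M[C]_N) : \det g = 1 ->
  exists k h : 'M[C]_N, exists lam : 'rV[R]_N,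
    [/\ k \is unitarymx, h \is unitarymx, \det h = 1, \sum_j lam 0 j = 0
      & k *m g = torus lam *m h].
Proof.
move=> g1; have [|k [u [t [ku uu t0 kg0]]]] := @svd _ _ g; first by rewrite g1 oner_eq0.
pose lam : 'rV[R]_N := \row_j ln (complex.Re (t 0 j)).
have kg : k *m g = torus lam *m u.
  rewrite kg0; congr (diag_mx _ *m _); apply/rowP => j; rewrite !mxE.
  have := t0 j; move: (t 0 j) => z; rewrite ltcE/= => /andP[/eqP iz rz].
  by rewrite lnK//; case: z iz rz => a b /= ->.
have lam0 : \sum_j lam 0 j = 0.
  have := congr1 (fun M : 'M[C]_N => `|\det M|) kg.
  rewrite !det_mulmx g1 mulr1 det_torus normrM !unitary_det// mulr1 => h.
  apply: expR_inj; rewrite expR0; apply: complexI.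
  by rewrite [RHS]h ger0_norm// ler0c expR_ge0.
have du : `|(\det u)^-1| = 1 by rewrite normrV ?unitary_det ?invr1// unitfE -normr_eq0 unitary_det// oner_eq0.
(* e absorbs the determinant of u, of modulus 1, in a single entry *)
pose e : 'rV[C]_N := \row_j (if j == 0 then (\det u)^-1 else 1).
have eu : diag_mx e \is unitarymx.
  apply/unitarymxP; rewrite tr_diag_mx map_diag_mx mulmx_diag -diag_const_mx.
  congr diag_mx; apply/rowP => j; rewrite !mxE -normCK.
  by case: ifP; rewrite ?du ?normr1 expr1n.
exists (diag_mx e *m k), (diag_mx e *m u), lam; split.
- exact: mul_unitarymx.
- exact: mul_unitarymx.
- rewrite det_mulmx det_diag (bigD1 0)//= mxE eqxx big1 => [|j j0].
    by rewrite mulr1 mulVf// -normr_eq0 unitary_det// oner_eq0.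
  by rewrite mxE (negPf j0).
- exact: lam0.
by rewrite -mulmxA kg !mulmxA diag_mxC.
Qed.

End CartanDecomposition.

(** * Matrices with bounded powers *)

Lemma row_neq0P (K : nmodType) p (u : 'rV[K]_p) : u != 0 -> exists j, u 0 j != 0.
Proof.
move=> u0; apply: contrapT => /forallNP h; move/eqP: u0; apply.
by apply/rowP => j; rewrite mxE; apply/eqP/negPn/negP; exact: h.
Qed.

Lemma row_unitmx_neq0 (K : fieldType) p (P : 'M[K]_p) j : P \in unitmx -> row j P != 0.
Proof.
move=> Pu; apply: contraTneq Pu => Pj; rewrite -row_free_unit.
apply/negP => /row_freeP[Q /(congr1 (row j))]; rewrite row_mul Pj mul0mx.
by move=> /rowP/(_ j)/eqP; rewrite !mxE eqxx eq_sym oner_eq0.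
Qed.

Section BoundedPowers.
Variables (R : realType) (n : nat).
Local Notation C := R[i].
Local Notation N := n.+1.
Implicit Types (g h : 'M[C]_N) (u w : 'rV[C]_N) (a : C).

(** By Bernoulli's inequality. *)
Lemma le1_of_bounded_powers (x B : R) : (forall k, x ^+ k <= B) -> x <= 1.
Proof.
move=> xB; rewrite leNgt; apply/negP => x1.
have bern k : 1 + k%:R * (x - 1) <= x ^+ k.
  elim: k => [|k IH]; first by rewrite mul0r addr0 expr0.
  rewrite exprS -natr1; have : 0 <= k%:R :> R by [].
  have /(ler_wpM2l (ltW (lt_trans ltr01 x1))) := IH.
  have := sqr_ge0 (x - 1).
  by set y := x ^+ k; set c := k%:R; nra.
have x0 : 0 < x - 1 by rewrite subr_gt0.
have := le_trans (bern (Num.bound (`|B| / (x - 1)))) (xB _).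
have := archi_boundP (divr_ge0 (normr_ge0 B) (ltW x0)).
rewrite ltr_pdivrMr// => h1 h2.
by have := ler_norm B; lra.
Qed.

Section Powers.
Variables (g : 'M[C]_N) (B : R).
Hypothesis gu : g \in unitmx.
Hypothesis gB : forall k i j, normc ((g ^+ k) i j) <= B.
Hypothesis giB : forall k i j, normc ((invmx g ^+ k) i j) <= B.

Lemma eigen_powers h u a k : u *m h = a *: u -> u *m h ^+ k = a ^+ k *: u.
Proof.
move=> uh; elim: k => [|k IH]; first by rewrite !expr0 mulmx1 scale1r.
by rewrite !exprS mulmxA uh -scalemxAl IH scalerA.
Qed.

Lemma eigen_bounded h u a : (forall k i j, normc ((h ^+ k) i j) <= B) ->
  u != 0 -> u *m h = a *: u -> normc a <= 1.
Proof.
move=> hB /row_neq0P[j uj] uh.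
have uj0 : 0 < normc (u 0 j) by rewrite normc_gt0.
apply: (@le1_of_bounded_powers _ ((\sum_i normc (u 0 i)) * B / normc (u 0 j))) => k.
rewrite ler_pdivlMr// -normcX -normcM.
have := normc_mulmx_le u (hB k) j.
by rewrite (eigen_powers k uh) mxE.
Qed.

(** The bounds on the powers of g and of its inverse give |a| <= 1 and |a| >=
    1. *)
Lemma eigen_unimodular u a : u != 0 -> u *m g = a *: u -> normc a = 1.
Proof.
move=> u0 ug; have a1 := eigen_bounded gB u0 ug.
have a0 : a != 0.
  apply: contra u0 => /eqP a0.
  by rewrite -[u](mulmxK gu) ug a0 scale0r mul0mx.
have ugi : u *m invmx g = a^-1 *: u.
  by apply: (canLR (mulmxK gu)); rewrite -scalemxAl ug scalerA mulVf ?scale1r.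
have := eigen_bounded giB u0 ugi; rewrite normcV.
have ap : 0 < normc a by rewrite normc_gt0.
by rewrite invf_le1// => ?; apply/eqP; rewrite eq_le a1.
Qed.

(** On the block, w g^k = a^k w + k a^(k-1) u with a of modulus 1. *)
Lemma no_jordan_block u w a : u != 0 -> u *m g = a *: u -> w *m g = a *: w + u ->
  False.
Proof.
move=> u0 ug wg; have a1 := eigen_unimodular u0 ug.
have wk k : w *m g ^+ k.+1 = a ^+ k.+1 *: w + (k.+1%:R * a ^+ k) *: u.
  elim: k => [|k IH]; first by rewrite !expr1 expr0 mulr1 scale1r.
  rewrite exprSr mulmxA IH mulmxDl -!scalemxAl wg ug scalerDr !scalerA.
  rewrite -addrA -scalerDl -exprSr; congr (_ + _ *: _).
  by rewrite -mulrA -exprSr -[in RHS]natr1 mulrDl mul1r addrC.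
have [j uj] := row_neq0P u0.
have uj0 : 0 < normc (u 0 j) by rewrite normc_gt0.
pose D := (\sum_i normc (w 0 i)) * B + normc (w 0 j).
have bd k : k.+1%:R * normc (u 0 j) <= D.
  have := normc_mulmx_le w (gB k.+1) j; rewrite wk !mxE => h.
  have -> : k.+1%:R * normc (u 0 j) = normc (k.+1%:R * a ^+ k * u 0 j).
    by rewrite !normcM normcX a1 expr1n mulr1 normcMn normc1.
  have -> : k.+1%:R * a ^+ k * u 0 j =
      (a ^+ k.+1 * w 0 j + k.+1%:R * a ^+ k * u 0 j) + - (a ^+ k.+1 * w 0 j).
    by rewrite addrC addKr.
  rewrite (le_trans (le_normcD _ _))// lerD//.
  by rewrite normcN normcM normcX a1 expr1n mul1r.
have D0 : 0 <= D by apply: le_trans (bd 0); rewrite mulr_ge0// ltW.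
have := archi_boundP (divr_ge0 D0 (ltW uj0)).
rewrite ltr_pdivrMr// => h1.
have := bd (Num.bound (D / normc (u 0 j))); rewrite -natr1 mulrDl mul1r.
by lra.
Qed.

(** A double root of the minimal polynomial produces a Jordan block, along
    which powers grow linearly. *)
Lemma bounded_powers_diagonalizable :
  exists (P : 'M[C]_N) (a : 'rV[C]_N), [/\ P \in unitmx,
    P *m g = diag_mx a *m P & forall j, normc (a 0 j) = 1].
Proof.
have : diagonalizable g.
  apply/diagonalizableP.
  have [r rE] := closed_field_poly_normal (mxminpoly g).
  rewrite (monicP (mxminpoly_monic g)) scale1r in rE.
  exists r; last by rewrite rE.
  apply/negPn/negP => /(uniqPn 0)[i [j [ij js rij]]].
  pose a := r`_i.
  have ar : a \in r by apply: mem_nth; apply: ltn_trans js.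
  have ar' : a \in rem a r.
    rewrite -has_pred1 has_count count_rem ar/= eqxx subn_gt0.
    rewrite -(cat_take_drop j r) count_cat.
    apply: (@leq_add 1 1).
      rewrite -has_count has_pred1 /a -(nth_take _ ij); apply: mem_nth.
      by rewrite size_take js.
    rewrite -has_count has_pred1 /a rij -[j in r`_j]addn0 -nth_drop; apply: mem_nth.
    by rewrite size_drop subn_gt0.
  pose q := \prod_(x <- rem a (rem a r)) ('X - x%:P).
  have pE : mxminpoly g = ('X - a%:P) * (('X - a%:P) * q).
    rewrite rE (perm_big _ (perm_to_rem ar)) big_cons; congr (_ * _).
    by rewrite (perm_big _ (perm_to_rem ar')) big_cons.
  have nz : horner_mx g (('X - a%:P) * q) != 0.
    rewrite -dvd_mxminpoly; apply/negP => /dvdp_leq.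
    have q0 : ('X - a%:P) * q != 0.
      by rewrite mulf_neq0 ?polyXsubC_eq0// monic_neq0// monic_prod_XsubC.
    by move=> /(_ q0); rewrite pE (size_monicM (monicXsubC a) q0) size_XsubC ltnn.
  have XaE : horner_mx g ('X - a%:P) = g - a%:M.
    by rewrite rmorphB/= horner_mx_X horner_mx_C.
  have [l rl] : exists l, row l (horner_mx g (('X - a%:P) * q)) != 0.
    apply: contrapT => /forallNP h; move/eqP: nz; apply.
    by apply/row_matrixP => l; rewrite row0; apply/eqP/negPn/negP; exact: h.
  have comm p : horner_mx g p *m horner_mx g ('X - a%:P) = horner_mx g (('X - a%:P) * p).
    by rewrite -[_ *m _]/(_ * _) -rmorphM/= mulrC.
  apply: (@no_jordan_block _ (row l (horner_mx g q)) a rl).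
    apply/eqP; rewrite -subr_eq0 -mul_mx_scalar -mulmxBr -XaE -row_mul comm -pE.
    by rewrite mx_root_minpoly row0.
  by rewrite -comm row_mul XaE mulmxBr mul_mx_scalar addrC subrK.
move=> [P Pu /(diagonalizable_forPex)[a /(simmxP Pu) PgE]].
exists P, a; split => // j; apply: (eigen_unimodular (row_unitmx_neq0 j Pu)).
by rewrite -row_mul PgE row_mul row_diag_mx -scalemxAl -rowE.
Qed.

End Powers.
End BoundedPowers.

(** * Points of the unit circle near 1 *)

Section UnitCircle.
Variable R : realType.
Local Notation C := R[i].

Definition cis (x : R) : C := Complex (cos x) (sin x).

Lemma cisD x y : cis (x + y) = cis x * cis y.
Proof.
by rewrite /cis cosD sinD; congr Complex; rewrite addrC mulrC [X in _ + X]mulrC.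
Qed.

Lemma cis0 : cis 0 = 1.
Proof. by rewrite /cis cos0 sin0. Qed.

Lemma cis_sum (J : Type) (r : seq J) (P : pred J) (x : J -> R) :
  cis (\sum_(j <- r | P j) x j) = \prod_(j <- r | P j) cis (x j).
Proof. exact: (big_morph _ cisD cis0). Qed.

Lemma cis_natr x k : cis (x * k%:R) = cis x ^+ k.
Proof.
elim: k => [|k IH]; first by rewrite mulr0 expr0 cis0.
by rewrite -natr1 mulrDr mulr1 cisD IH exprSr.
Qed.

(** A multiple of 2 pi of absolute value less than pi is zero: this is how a
    condition on eigenvalues becomes a linear condition on angles. *)
Lemma cis_eq1 x : `|x| < pi -> cis x = 1 -> x = 0.
Proof.
move=> xpi [_ sx]; apply/eqP; move: xpi; rewrite ltr_norml => /andP[x1 x2].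
case: (ltgtP x 0) => // x0.
  have := @sin_gt0_pi R (- x); rewrite sinN sx oppr0 ltxx => -> //.
  by rewrite oppr_gt0 x0/= ltrNl.
by have := @sin_gt0_pi R x; rewrite sx ltxx x0 x2 => ->.
Qed.

(** The angle is the arcsine of the imaginary part, which is continuous at 0.
    *)
Lemma small_angle (eta : R) : 0 < eta -> exists2 delta : R, 0 < delta &
  forall a : C, normc a = 1 -> normc (a - 1) < delta ->
    exists2 x : R, `|x| < eta & a = cis x.
Proof.
move=> eta0.
have : {for 0, continuous (@asin R)}.
  by apply: continuous_asin; rewrite ltrN10 ltr01.
move=> /cvgrPdist_lt/(_ _ eta0)/nbhs_ballP[d /= d0 dP].
exists (Num.min d 1); first by rewrite lt_min d0 ltr01.
move=> [p q] a1; rewrite lt_min => /andP[ad ad1].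
have pq : p ^+ 2 + q ^+ 2 = 1.
  have : Num.sqrt (p ^+ 2 + q ^+ 2) = 1 := a1.
  by move/(congr1 (fun x => x ^+ 2)); rewrite sqr_sqrtr ?expr1n// addr_ge0 ?sqr_ge0.
have hp := normc_Re ((p +i* q) - 1); have hq := normc_Im ((p +i* q) - 1).
have {hp} hp : `|p - 1| <= normc ((p +i* q) - 1) := hp.
have {hq} hq : `|q| <= normc ((p +i* q) - 1) by move: hq; rewrite /= subr0.
have p0 : 0 < p.
  by have := le_lt_trans hp ad1; rewrite ltr_norml => /andP[]; lra.
have qin : -1 <= q <= 1 by apply/andP; split; nra.
exists (asin q).
  have asin0 : asin (0 : R) = 0.
    rewrite -[X in asin X](@sin0 R) sinK// in_itv/= oppr_le0 andbb.
    by rewrite divr_ge0// pi_ge0.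
  rewrite -normrN -[- _]add0r -{1}asin0; apply: dP.
  by rewrite /ball/= sub0r normrN (le_lt_trans hq).
rewrite /cis cos_asin// asinK ?in_itv//=.
by rewrite -pq addrK sqrtr_sqr gtr0_norm.
Qed.

End UnitCircle.

(** * Representations with a basis of weight vectors *)

Section LinearCombinations.
Variables (K : fieldType) (U V : lmodType K) (J : finType).

Lemma linear_comb (f : U -> V) (c : J -> K) (u : J -> U) : linear f ->
  f (\sum_j c j *: u j) = \sum_j c j *: f (u j).
Proof.
move=> fl; elim/big_rec2: _ => [|j x y _ <-]; last by rewrite fl.
by have := fl (-1) 0 0; rewrite scaler0 addr0 scaleN1r addNr.
Qed.

Lemma scalar_comb (f : U -> K) (c : J -> K) (u : J -> U) : scalar f ->
  f (\sum_j c j *: u j) = \sum_j c j * f (u j).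
Proof.
move=> fl; elim/big_rec2: _ => [|j x y _ <-]; last by rewrite fl.
by have := fl (-1) 0 0; rewrite scaler0 addr0 mulN1r addNr.
Qed.

End LinearCombinations.

Section WeightReps.
Variables (R : realType) (n : nat).
Local Notation C := R[i].
Local Notation N := n.+1.

(** The common interface of the two representations, on forms of a given degree
    and on an exterior power: a basis [b] of weight vectors for the diagonal
    torus, the dual coordinates [phi] and the exponents [chi].  The last field
    is the continuity of g |-> g w, in the form in which limits use it; it
    holds because the action is polynomial in the entries of g. *)
Record weight_rep (W : vectType C) (act : 'M[C]_N -> W -> W)
    (I : finType) (b : I -> W) (phi : I -> W -> C) (chi : I -> 'I_N -> nat) := {
  wr_linear : forall g, linear (act g);
  wr_act1 : forall w, act 1%:M w = w;
  wr_actM : forall g h w, act (g *m h) w = act g (act h w);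
  wr_phi_linear : forall i, scalar (phi i);
  wr_phi_basis : forall i j, phi i (b j) = (i == j)%:R;
  wr_phi_span : forall w, w = \sum_i phi i w *: b i;
  wr_diag : forall t i,
    act (diag_mx t) (b i) = (\prod_j t 0 j ^+ chi i j) *: b i;
  wr_ctends : forall (F : set_system nat) (FF : ProperFilter F)
      (g : nat -> 'M[C]_N) (g0 : 'M[C]_N),
    (forall i j, ctends F (fun m => g m i j) (g0 i j)) ->
    forall w i, ctends F (fun m => phi i (act (g m) w)) (phi i (act g0 w)) }.

Variables (W : vectType C) (act : 'M[C]_N -> W -> W) (I : finType).
Variables (b : I -> W) (phi : I -> W -> C) (chi : I -> 'I_N -> nat).
Hypothesis rep : weight_rep act b phi chi.
Implicit Types (lam mu : 'rV[R]_N) (g h k : 'M[C]_N) (v w : W).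

Lemma phi_sum i (J : finType) (c : J -> C) (w : J -> W) :
  phi i (\sum_j c j *: w j) = \sum_j c j * phi i (w j).
Proof. exact: scalar_comb (wr_phi_linear rep i). Qed.

Lemma act_sum g (J : finType) (c : J -> C) (w : J -> W) :
  act g (\sum_j c j *: w j) = \sum_j c j *: act g (w j).
Proof. exact: linear_comb (wr_linear rep g). Qed.

Lemma phi_inj v w : (forall i, phi i v = phi i w) -> v = w.
Proof.
move=> vw; rewrite (wr_phi_span rep v) (wr_phi_span rep w).
by apply: eq_bigr => i _; rewrite vw.
Qed.

Lemma phi0 i : phi i 0 = 0.
Proof.
by have := wr_phi_linear rep i (-1) 0 0; rewrite scaler0 addr0 mulN1r addNr.
Qed.

Lemma phi_act i g w : phi i (act g w) = \sum_j phi j w * phi i (act g (b j)).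
Proof. by rewrite {1}(wr_phi_span rep w) act_sum phi_sum. Qed.

Lemma phi_diag i t w :
  phi i (act (diag_mx t) w) = (\prod_j t 0 j ^+ chi i j) * phi i w.
Proof.
rewrite phi_act (bigD1 i)//= big1 ?addr0 => [|j ji].
  by rewrite (wr_diag rep) -[_ *: _](addr0) (wr_phi_linear rep) phi0 addr0
     (wr_phi_basis rep) eqxx mulr1 mulrC.
rewrite (wr_diag rep) -[_ *: _](addr0) (wr_phi_linear rep) phi0 addr0.
by rewrite (wr_phi_basis rep) eq_sym (negPf ji) !mulr0.
Qed.

Definition wt lam i : R := \sum_j lam 0 j * (chi i j)%:R.

Lemma wtZ c lam i : wt (c *: lam) i = c * wt lam i.
Proof. by rewrite /wt mulr_sumr; apply: eq_bigr => j _; rewrite mxE mulrA. Qed.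

Lemma phi_torus i lam w :
  phi i (act (torus lam) w) = (expR (wt lam i))%:C * phi i w.
Proof.
rewrite phi_diag; congr (_ * _); rewrite expR_sum rmorph_prod/=.
apply: eq_bigr => j _; rewrite mxE -rmorphXn/= -expRM_natr.
by [].
Qed.

(** The basis in which the closure is defined can be replaced by the weight
    basis, since the two coordinate systems are linear in each other. *)
Lemma vclosureP (A : set W) y : vclosure A y <->
  exists a : nat -> W, (forall m, A (a m)) /\
    forall i, ctends \oo (fun m => phi i (a m)) (phi i y).
Proof.
pose e := vbasis {:W}.
have eP w : w = \sum_j coord e j w *: e`_j.
  by apply: coord_vbasis; rewrite memvf.
split=> [|[a [aA ay]]].
  move=> /closure_rV cA.
  have /choice[a aP] : forall m : nat, exists w : W, A w /\
      forall j, normc (coords w 0 j - coords y 0 j) < m.+1%:R^-1.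
    move=> m; have [|_ [w Aw <-] h] := cA (m.+1%:R^-1)%:C.
      by rewrite ltcR invr_gt0.
    exists w; split => // j; have := h j.
    by rewrite distrC -ltcR.
  exists a; split=> [m|i]; first by have [] := aP m.
  rewrite (eP y) phi_sum.
  apply: eq_ctends (_ : ctends _ (fun m => \sum_j coord e j (a m) * phi i e`_j) _).
    by move=> m; rewrite [in RHS](eP (a m)) phi_sum.
  apply: ctends_sum => j _; apply: ctendsM _ (ctends_cst _).
  apply/ctendsP => eps eps0.
  have := near_infty_natSinv_lt (PosNum eps0); apply: filterS => m /= me.
  by apply: lt_trans me; have [_ /(_ j)] := aP m; rewrite !mxE.
apply/closure_rV => eps eps0.
have eps0' : 0 < complex.Re eps by move: eps0; rewrite ltcE => /andP[].
have epsE : eps = (complex.Re eps)%:C.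
  by move: eps0; rewrite ltcE => /andP[/eqP]; case: (eps) => p q /= ->.
have ca j : ctends \oo (fun m => coord e j (a m)) (coord e j y).
  have cE w : coord e j w = \sum_i phi i w * coord e j (b i).
    rewrite {1}(wr_phi_span rep w) linear_sum.
    by apply: eq_bigr => i _; rewrite linearZ.
  rewrite cE; apply: eq_ctends (_ : ctends _ (fun m => \sum_i phi i (a m) * coord e j (b i)) _).
    by move=> m; rewrite [in RHS]cE.
  by apply: ctends_sum => i _; apply: ctendsM _ (ctends_cst _).
have : \forall m \near \oo, forall j, normc (coord e j (a m) - coord e j y) < complex.Re eps.
  by apply: filter_forall => j; have /ctendsP := ca j; apply.
move=> /filter_ex[m hm]; exists (coords (a m)); first by exists (a m).
by move=> j; rewrite distrC epsE !mxE; have := hm j; rewrite -ltcR.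
Qed.

End WeightReps.

(** * The Hilbert-Mumford criterion *)

Section HilbertMumford.
Variables (R : realType) (n : nat).
Local Notation C := R[i].
Local Notation N := n.+1.
Variables (W : vectType C) (act : 'M[C]_N -> W -> W) (I : finType).
Variables (b : I -> W) (phi : I -> W -> C) (chi : I -> 'I_N -> nat).
Hypothesis rep : weight_rep act b phi chi.
Implicit Types (lam mu : 'rV[R]_N) (g h k : 'M[C]_N) (v w : W).
Local Notation wt := (wt chi).

(** A real vector [lam] is as good as an integral one, because only the limit
    of [torus (- s *: lam)] for real [s] matters. *)
Definition destabilized v : Prop := exists h lam,
  [/\ \det h = 1, \sum_j lam 0 j = 0
    & forall i, phi i (act h v) != 0 -> 0 < wt lam i].

Definition weakly_destabilized v : Prop := exists h lam,
  [/\ \det h = 1, lam != 0, \sum_j lam 0 j = 0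
    & forall i, phi i (act h v) != 0 -> 0 <= wt lam i].

Lemma det_ray (s : R) lam h : \det h = 1 -> \sum_j lam 0 j = 0 ->
  \det (torus (s *: lam) *m h) = 1.
Proof.
move=> h1 l0; rewrite det_mulmx h1 mulr1 det_torus.
have -> : \sum_j (s *: lam) 0 j = 0.
  transitivity (s * \sum_j lam 0 j); last by rewrite l0 mulr0.
  by rewrite mulr_sumr; apply: eq_bigr => j _; rewrite mxE.
by rewrite expR0.
Qed.

(** Along the ray, the coordinates of positive weight decay and those of weight
    zero stay. *)
Lemma ray_limit v h lam (c : I -> C) :
    (forall i, phi i (act h v) != 0 -> 0 <= wt lam i) ->
    (forall i, c i = if wt lam i == 0 then phi i (act h v) else 0) ->
  forall i, ctends \oo (fun m => phi i (act (torus (- m%:R *: lam) *m h) v)) (c i).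
Proof.
move=> lamP cE i; rewrite cE.
have phiE m : phi i (act (torus (- m%:R *: lam) *m h) v) =
    (expR (- wt lam i) ^+ m)%:C * phi i (act h v).
  rewrite (wr_actM rep) (phi_torus rep) wtZ -expRM_natl.
  by rewrite mulNr mulrN.
have [wt0|wt0] := eqVneq (wt lam i) 0.
  apply: eq_ctends (ctends_cst _) => m.
  by rewrite phiE wt0 oppr0 expR0 expr1n mul1r.
have [p0|p0] := eqVneq (phi i (act h v)) 0.
  by apply: eq_ctends (ctends_cst _) => m; rewrite phiE p0 mulr0.
have wt_gt0 : 0 < wt lam i by rewrite lt_neqAle eq_sym wt0 lamP.
rewrite -(mul0r (phi i (act h v))).
apply: eq_ctends (ctendsM _ (ctends_cst _)) => [m|]; first by rewrite phiE.
apply: ctends_real; apply: cvg_expr.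
by rewrite ger0_norm ?expR_ge0// -expR0 ltr_expR oppr_lt0.
Qed.

Lemma destabilized_unstable v : destabilized v -> ~ git_semistable act v.
Proof.
move=> [h [lam [h1 lam0 lamP]]]; apply; apply/(vclosureP rep).
exists (fun m => act (torus (- m%:R *: lam) *m h) v); split=> [m|i].
  by exists (torus (- m%:R *: lam) *m h) => //; exact: det_ray.
rewrite (phi0 rep); move: i; apply: (@ray_limit _ _ _ (fun=> 0)) => i.
  by move=> /lamP/ltW.
case: eqP => // wt0; apply/esym/eqP/negPn/negP => /lamP.
by rewrite wt0 ltxx.
Qed.

(** The analytic core of the criterion.  If g_m v converges, so does k_m g_m v
    = torus (lam_m) h_m v, where k_m and h_m converge by compactness of the
    unitary group; a coordinate that does not vanish on h v then keeps exp (wt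
    lam_m) bounded, and forces it to be small if the limit is 0.  The last
    clause says that g_m is large only if lam_m is. *)
Lemma cartan_limit (U : set_system nat) (UU : UltraFilter U)
    (g : nat -> 'M[C]_N) v (y : I -> C) :
    (forall m, \det (g m) = 1) ->
    (forall i, ctends U (fun m => phi i (act (g m) v)) (y i)) ->
  exists (lam : nat -> 'rV[R]_N) (h : 'M[C]_N),
    [/\ \det h = 1, forall m, \sum_j lam m 0 j = 0,
      forall i, phi i (act h v) != 0 ->
        exists2 M : R, U [set m | expR (wt (lam m) i) < M] &
          ((forall i, y i = 0) -> U [set m | expR (wt (lam m) i) < 1])
      & forall m r, (forall j, lam m 0 j <= r) ->
        forall i j, normc (g m i j) <= N%:R * expR r].
Proof.
move=> g1 gy.
have /choice[t tP] : forall m, exists t : 'M[C]_N * 'M[C]_N * 'rV[R]_N,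
    [/\ t.1.1 \is unitarymx, t.1.2 \is unitarymx, \det t.1.2 = 1,
        \sum_j t.2 0 j = 0 & t.1.1 *m g m = torus t.2 *m t.1.2].
  by move=> m; have [k [h [lam ?]]] := cartan_SL (g1 m); exists (k, h, lam).
pose k m := (t m).1.1; pose h m := (t m).1.2; pose lam m := (t m).2.
have [k0 kk0] : exists k0 : 'M[C]_N, forall i j, ctends U (fun m => k m i j) (k0 i j).
  apply: (@ultra_ctends_mx _ _ _ _ _ _ _ 1); apply: filterE => m i j.
  by have [ku _ _ _ _] := tP m; exact: unitary_entry.
have [h0 hh0] : exists h0 : 'M[C]_N, forall i j, ctends U (fun m => h m i j) (h0 i j).
  apply: (@ultra_ctends_mx _ _ _ _ _ _ _ 1); apply: filterE => m i j.
  by have [_ hu _ _ _] := tP m; exact: unitary_entry.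
exists lam, h0; split.
- apply: (ctends_unique (ctends_det hh0)).
  by apply: eq_ctends (ctends_cst _) => m; have [_ _ ->] := tP m.
- by move=> m; have [_ _ _ ->] := tP m.
- move=> i hi.
  have [z [zlim z0]] : exists z, ctends U
      (fun m => (expR (wt (lam m) i))%:C * phi i (act (h m) v)) z /\
      ((forall i, y i = 0) -> z = 0).
    exists (\sum_j y j * phi i (act k0 (b j))); split; last first.
      by move=> y0; rewrite big1// => j _; rewrite y0 mul0r.
    apply: eq_ctends (_ : ctends _ (fun m => \sum_j phi j (act (g m) v) * phi i (act (k m) (b j))) _).
      move=> m; rewrite -(phi_act rep) -(wr_actM rep).
      have [_ _ _ _ ->] := tP m.
      by rewrite (wr_actM rep) (phi_torus rep).
    by apply: ctends_sum => j _; apply: ctendsM => //; exact: (wr_ctends rep).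
  pose c := normc (phi i (act h0 v)) / 2.
  have hlow : U [set m | c < normc (phi i (act (h m) v))].
    by apply: ctends_lbound => //; exact: (wr_ctends rep).
  have c0 : 0 < c.
    by rewrite divr_gt0// normc_gt0.
  have normE m : normc ((expR (wt (lam m) i))%:C * phi i (act (h m) v)) =
      expR (wt (lam m) i) * normc (phi i (act (h m) v)).
    by rewrite normcM normc_real ger0_norm ?expR_ge0.
  have bound A : U [set m | normc ((expR (wt (lam m) i))%:C * phi i (act (h m) v)) < A] ->
      U [set m | expR (wt (lam m) i) < A / c].
    move=> UA; apply: filterS2 UA hlow => m /=; rewrite normE ltr_pdivlMr//.
    by move=> h1 h2; apply: le_lt_trans h1; rewrite ler_pM2l ?expR_gt0// ltW.
  exists ((normc z + 1) / c); first by apply: bound; apply: ctends_ubound.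
  move=> /z0 zE; rewrite zE in zlim.
  rewrite -(divff (lt0r_neq0 c0)); apply: bound.
  by move/ctends0P: zlim; apply.
- move=> m r lamr i j; have [ku hu _ _ kg] := tP m.
  have [k' ku' k'k] := unitary_left_inverse ku.
  have -> : g m = k' *m (torus (lam m) *m h m) by rewrite -kg mulmxA k'k mul1mx.
  have entry i' j' : normc ((torus (lam m) *m h m) i' j') <= expR r.
    rewrite mul_diag_mx !mxE normcM normc_real ger0_norm ?expR_ge0//.
    rewrite -[leRHS]mulr1 ler_pM ?expR_ge0 ?normc_ge0 ?ler_expR//.
    exact: unitary_entry.
  rewrite mxE (le_trans (normc_sum _ _ _))//.
  rewrite mulr_natl -[N in leRHS]card_ord -sumr_const; apply: ler_sum => l _.
  rewrite normcM -[leRHS]mul1r ler_pM ?normc_ge0//.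
  exact: unitary_entry.
Qed.

(** A single large index m serves, because the finitely many weights of h v are
    all negative on lam_m at once. *)
Lemma unstable_destabilized v : ~ git_semistable act v -> destabilized v.
Proof.
move=> /contrapT/(vclosureP rep)[a [av a0]].
have /choice[g gP] : forall m, exists g, \det g = 1 /\ act g v = a m.
  by move=> m; have [g ? <-] := av m; exists g.
have [U [UU ooU]] := ultra_oo.
have gy i : ctends U (fun m => phi i (act (g m) v)) (phi i 0).
  apply: eq_ctends (ctends_filterS ooU (a0 i)) => m.
  by have [_ ->] := gP m.
have [lam [h [h1 lam0 hP _]]] := cartan_limit UU (fun m => (gP m).1) gy.
have : U [set m | forall i, phi i (act h v) != 0 -> expR (wt (lam m) i) < 1].
  apply: filter_forall => i.
  have [hi|hi] := eqVneq (phi i (act h v)) 0.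
    by apply: filterE => m.
  have [M _ /(_ (fun i => phi0 rep i))] := hP i hi.
  by apply: filterS => m.
move=> /filter_ex[m mP]; exists h, (- lam m); split => //.
  by under eq_bigr do rewrite mxE; rewrite sumrN lam0 oppr0.
move=> i /mP; rewrite -expR0 ltr_expR -scaleN1r wtZ mulN1r oppr_gt0.
by [].
Qed.

Lemma hilbert_mumford_semistable v : git_semistable act v <-> ~ destabilized v.
Proof.
split=> [ss /destabilized_unstable//|nd].
by apply: contrapT => /unstable_destabilized.
Qed.

End HilbertMumford.

Section HilbertMumfordStable.
Variables (R : realType) (n : nat).
Local Notation C := R[i].
Local Notation N := n.+1.
Variables (W : vectType C) (act : 'M[C]_N -> W -> W) (I : finType).
Variables (b : I -> W) (phi : I -> W -> C) (chi : I -> 'I_N -> nat).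
Hypothesis rep : weight_rep act b phi chi.
Implicit Types (lam mu : 'rV[R]_N) (g h k : 'M[C]_N) (v w : W).
Local Notation wt := (wt chi).

Lemma act_invmxK g w : g \in unitmx -> act (invmx g) (act g w) = w.
Proof. by move=> gu; rewrite -(wr_actM rep) mulVmx// (wr_act1 rep). Qed.

Lemma act0 g : act g 0 = 0.
Proof.
by have := wr_linear rep g (-1) 0 0; rewrite scaler0 addr0 scaleN1r addNr.
Qed.

Lemma act_neq0 g w : g \in unitmx -> w != 0 -> act g w != 0.
Proof. by move=> gu; apply: contra => /eqP gw; rewrite -(act_invmxK w gu) gw act0. Qed.

Lemma torus_inj (s t : R) lam : lam != 0 -> torus (s *: lam) = torus (t *: lam) -> s = t.
Proof.
move=> /row_neq0P[j lj] st.
have := congr1 (fun M : 'M[C]_N => M j j) st.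
by rewrite !mxE eqxx !mulr1n => /complexI/expR_inj/(mulIf lj).
Qed.

(** The limit y of the ray is fixed by the ray.  If the orbit is closed, y is a
    translate of v and the stabilizer of v contains a conjugate of the ray. *)
Lemma weakly_destabilized_nonstable v :
  weakly_destabilized act phi chi v -> ~ git_stable act v.
Proof.
move=> [h [lam [h1 lam0 lams lamP]]] [_ cl fin].
(* the limit of the ray at h v *)
pose c i := if wt lam i == 0 then phi i (act h v) else 0.
pose y := \sum_i c i *: b i.
have phiy i : phi i y = c i.
  rewrite (phi_sum rep) (bigD1 i)//= (wr_phi_basis rep) eqxx mulr1 big1 ?addr0// => j ji.
  by rewrite (wr_phi_basis rep) eq_sym (negPf ji) mulr0.
have [g g1 gy] : orbit act v y.
  rewrite -cl; apply/(vclosureP rep).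
  exists (fun m => act (torus (- m%:R *: lam) *m h) v); split=> [m|i].
    by exists (torus (- m%:R *: lam) *m h) => //; exact: det_ray.
  by rewrite phiy; exact: (ray_limit rep lamP (fun=> erefl)).
have gu : g \in unitmx by rewrite unitmxE [\det g]g1 unitr1.
have fix_y (s : R) : act (torus (s *: lam)) y = y.
  apply: (phi_inj rep) => i; rewrite (phi_torus rep) wtZ phiy /c.
  by case: eqP => [->|_]; rewrite ?mulr0 ?expR0 ?mul1r.
pose f (m : nat) := invmx g *m torus (m%:R *: lam) *m g.
have fstab m : stabilizer act v (f m).
  split; rewrite /f.
    rewrite /SL/= !det_mulmx det_inv [\det g]g1 invr1 mul1r mulr1.
    by have := @det_ray _ _ m%:R lam 1%:M; rewrite mulmx1 det1; apply.
  by rewrite !(wr_actM rep) gy fix_y -gy act_invmxK.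
have finj : injective f.
  have giu : invmx g \in unitmx by rewrite unitmx_inv.
  move=> s t /(can_inj (mulmxK gu))/(can_inj (mulKmx giu))/(torus_inj lam0)/eqP.
  by rewrite eqr_nat => /eqP.
apply: infinite_nat; apply: (sub_finite_set _ (finite_preimage _ fin)) => [m _|].
  exact: fstab.
by move=> s t _ _; exact: finj.
Qed.

(** Properness of the orbit map on SL, with boundedness read off coordinates.
    *)
Definition proper_orbit v : Prop := forall M : R, exists B : R,
  forall g, \det g = 1 -> (forall i, normc (phi i (act g v)) <= M) ->
  forall i j, normc (g i j) <= B.

(** Along a sequence violating properness the exponents lam_m are unbounded
    while the weights of h v on them are bounded above; the limit of lam_m /
    |lam_m| is thus nonpositive on these weights, and its opposite destabilizes
    weakly. *)
Lemma properI v : ~ weakly_destabilized act phi chi v -> proper_orbit v.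
Proof.
move=> nw; apply: contrapT => /existsNP[M /forallNP hM]; apply: nw.
have /choice[g gP] : forall m : nat, exists g, [/\ \det g = 1,
    forall i, normc (phi i (act g v)) <= M & exists i j, m%:R < normc (g i j)].
  move=> m; have /existsNP[g] := hM m%:R.
  move=> /not_implyP[g1 /not_implyP[gM /existsNP[i /existsNP[j /negP gij]]]].
  by exists g; split => //; exists i, j; rewrite ltNge.
have [U [UU ooU]] := ultra_oo.
have /choice[y yP] : forall i, exists y, ctends U (fun m => phi i (act (g m) v)) y.
  move=> i; apply: (@ultra_ctends _ _ _ _ _ M); apply: filterE => m.
  by have [_ + _] := gP m; apply.
have g1 m : \det (g m) = 1 by have [] := gP m.
have [lam [h [h1 lams hP growth]]] := cartan_limit rep UU g1 yP.
pose r m : R := \sum_j `|lam m 0 j|.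
have lam_le m j : `|lam m 0 j| <= r m.
  by rewrite /r (bigD1 j)//= lerDl sumr_ge0.
have r_large (A : R) : U [set m | A < r m].
  have : U [set m | N%:R * expR A <= m%:R :> R].
    apply: ooU; exists (Num.bound (N%:R * expR A)) => // m /= hm.
    have A0 : 0 <= N%:R * expR A :> R by rewrite mulr_ge0// expR_ge0.
    by rewrite (le_trans (ltW (archi_boundP A0)))// ler_nat.
  apply: filterS => m /= hm; rewrite ltNge; apply/negP => rA.
  have [_ _ [i [j mg]]] := gP m.
  have := growth m A (fun l => le_trans (ler_norm _) (le_trans (lam_le m l) rA)) i j.
  by move=> /(lt_le_trans mg); rewrite ltNge hm.
(* r m tends to infinity, and l m has entries whose absolute values sum to 1 *)
pose l m := (r m)^-1 *: lam m.
have r_ge0 m : 0 <= r m by exact: sumr_ge0.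
have /choice[l0 l0P] : forall j, exists x : R, l m 0 j @[m --> U] --> x.
  move=> j; apply: (@ultra_cvg _ _ _ _ _ 1); apply: filterE => m /=.
  rewrite mxE normrM normfV (ger0_norm (r_ge0 m)).
  have [r0|r0] := eqVneq (r m) 0; first by rewrite r0 invr0 mul0r ler01.
  by rewrite mulrC ler_pdivrMr ?mul1r// lt_neqAle eq_sym r0 r_ge0.
pose L : 'rV[R]_N := \row_j l0 j.
have cvg_sumR (J : Type) (s : seq J) (f : J -> nat -> R) (t : J -> R) :
    (forall j, f j m @[m --> U] --> t j) ->
    \sum_(j <- s) f j m @[m --> U] --> \sum_(j <- s) t j.
  move=> ft; elim: s => [|j s IH].
    by rewrite big_nil; under eq_fun do rewrite big_nil; exact: cvg_cst.
  by rewrite big_cons; under eq_fun do rewrite big_cons; exact: cvgD.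
have wtL i : wt (l m) i @[m --> U] --> wt L i.
  have -> : wt L i = \sum_j l0 j * (chi i j)%:R.
    by apply: eq_bigr => j _; rewrite mxE.
  by apply: cvg_sumR => j; exact: (cvgM (l0P j) (cvg_cst _)).
have L1 : \sum_j `|l0 j| = 1.
  have h2 : \sum_j `|l m 0 j| @[m --> U] --> \sum_j `|l0 j|.
    by apply: cvg_sumR => j; exact: (cvg_norm (l0P j)).
  have h3 : \sum_j `|l m 0 j| @[m --> U] --> (1 : R).
    apply: cvg_near_cst; apply: filterS (r_large 0) => m /= rm.
    under eq_bigr do rewrite mxE normrM normfV (ger0_norm (r_ge0 m)).
    by rewrite -mulr_sumr mulVf// gt_eqF.
  exact: (cvg_unique _ h2 h3).
have Ls : \sum_j l0 j = 0.
  have h2 : \sum_j l m 0 j @[m --> U] --> \sum_j l0 j by exact: cvg_sumR.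
  have h3 : \sum_j l m 0 j @[m --> U] --> (0 : R).
    have -> : (fun m => \sum_j l m 0 j) = fun=> 0.
      by apply/funext => m; under eq_bigr do rewrite mxE; rewrite -mulr_sumr lams mulr0.
    exact: cvg_cst.
  exact: (cvg_unique _ h2 h3).
exists h, (- L); split => //.
- apply/negP => /eqP/(congr1 -%R); rewrite opprK oppr0 => L0.
  have := L1; rewrite big1 => [/esym/eqP|j _]; first by rewrite oner_eq0.
  by have /rowP/(_ j) := L0; rewrite !mxE => ->; rewrite normr0.
- by under eq_bigr do rewrite !mxE; rewrite sumrN Ls oppr0.
move=> i hi; rewrite -scaleN1r wtZ mulN1r oppr_ge0 leNgt; apply/negP => wt0.
have [A UA _] := hP i hi.
pose e := wt L i / 2; have e0 : 0 < e by rewrite divr_gt0.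
have Ue : U [set m | e < wt (l m) i].
  have /cvgrPdist_lt/(_ e e0) := wtL i.
  apply: filterS => m /=; rewrite ltr_norml => /andP[_].
  by rewrite {1}[wt L i]splitr -/e; lra.
have [m [[/= m1 m2] m3]] := filter_ex (filterI (filterI UA Ue) (r_large (`|A| / e))).
have r0 : 0 < r m by apply: le_lt_trans m3; rewrite divr_ge0// ltW.
have lamE : wt (lam m) i = r m * wt (l m) i.
  by rewrite /l wtZ mulrA divff ?mul1r// gt_eqF.
move: m3; rewrite ltr_pdivrMr// => m3.
have h2 : r m * e <= wt (lam m) i by rewrite lamE ler_pM2l// ltW.
have := expR_ge1Dx (wt (lam m) i).
by have := ler_norm A; lra.
Qed.

End HilbertMumfordStable.

Section ProperOrbits.
Variables (R : realType) (n : nat).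
Local Notation C := R[i].
Local Notation N := n.+1.
Variables (W : vectType C) (act : 'M[C]_N -> W -> W) (I : finType).
Variables (b : I -> W) (phi : I -> W -> C) (chi : I -> 'I_N -> nat).
Hypothesis rep : weight_rep act b phi chi.
Implicit Types (lam mu : 'rV[R]_N) (g h : 'M[C]_N) (v w : W).
Local Notation wt := (wt chi).

Lemma orbit_closed v : proper_orbit act phi v -> vclosure (orbit act v) = orbit act v.
Proof.
move=> prop; apply/seteqP; split=> y; last first.
  by move=> oy; apply/(vclosureP rep); exists (fun=> y); split=> // i; exact: ctends_cst.
move=> /(vclosureP rep)[a [av ay]].
have /choice[g gP] : forall m, exists g, \det g = 1 /\ act g v = a m.
  by move=> m; have [g ? <-] := av m; exists g.
have [U [UU ooU]] := ultra_oo.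
have yU i : ctends U (fun m => phi i (a m)) (phi i y) by exact: ctends_filterS (ay i).
pose M := \sum_i (normc (phi i y) + 1).
have UM : U [set m | forall i, normc (phi i (act (g m) v)) <= M].
  apply: filter_forall => i.
  have : U [set m | normc (phi i (a m)) < normc (phi i y) + 1] by exact: ctends_ubound.
  apply: filterS => m /= h; rewrite (gP m).2 (le_trans (ltW h))//.
  rewrite /M (bigD1 i)//= lerDl sumr_ge0// => j _.
  by rewrite addr_ge0 ?normc_ge0.
have [B BP] := prop M.
have [g0 gg0] : exists g0 : 'M[C]_N, forall i j, ctends U (fun m => g m i j) (g0 i j).
  apply: (@ultra_ctends_mx _ _ _ _ _ _ _ B); apply: filterS UM => m /= h i j.
  by apply: BP h i j; exact: (gP m).1.
exists g0.
  apply: (ctends_unique (ctends_det gg0)).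
  by apply: eq_ctends (ctends_cst _) => m; rewrite (gP m).1.
apply: (phi_inj rep) => i.
apply: (ctends_unique (wr_ctends rep _ gg0 v i)).
by apply: eq_ctends (yU i) => m; rewrite (gP m).2.
Qed.

Lemma stabilizer_bounded v : proper_orbit act phi v ->
  exists B : R, forall g, stabilizer act v g -> forall i j, normc (g i j) <= B.
Proof.
move=> /(_ (\sum_i normc (phi i v)))[B BP]; exists B => g [g1 gv].
apply: BP => // i; rewrite gv (bigD1 i)//= lerDl sumr_ge0// => j _.
exact: normc_ge0.
Qed.

Lemma stabilizerM v g h :
  stabilizer act v g -> stabilizer act v h -> stabilizer act v (g *m h).
Proof.
move=> [g1 gv] [h1 hv]; split; last by rewrite (wr_actM rep) hv gv.
by rewrite /SL/= det_mulmx [\det g]g1 [\det h]h1 mulr1.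
Qed.

Lemma SL_unit g : SL g -> g \in unitmx.
Proof. by move=> g1; rewrite unitmxE [\det g]g1 unitr1. Qed.

Lemma stabilizerV v g : stabilizer act v g -> stabilizer act v (invmx g).
Proof.
move=> [g1 gv]; split; first by rewrite /SL/= det_inv [\det g]g1 invr1.
by rewrite -[in LHS]gv (act_invmxK rep)//; exact: SL_unit.
Qed.

Lemma stabilizerX v g k : stabilizer act v g -> stabilizer act v (g ^+ k).
Proof.
move=> gs; elim: k => [|k IH]; last by rewrite exprS; exact: stabilizerM.
by rewrite expr0; split; [rewrite /SL/= det1|exact: wr_act1 rep _].
Qed.

(** A sequence of distinct elements of a bounded stabilizer has a limit g0,
    which stabilizes v too, and g0^-1 f_m tends to 1. *)
Lemma infinite_stabilizer_near1 v : proper_orbit act phi v ->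
    infinite_set (stabilizer act v) -> forall e : R, 0 < e ->
  exists g, [/\ stabilizer act v g, g != 1%:M &
    forall i j, normc ((g - 1%:M) i j) < e].
Proof.
move=> /stabilizer_bounded[B BP] /infiniteP/pcard_leP[f] e e0.
have [U [UU ooU]] := ultra_oo.
have fs m : stabilizer act v (f m) by exact: funS.
have finj : injective f by move=> x y; apply: inj; exact: mem_set.
have [g0 fg0] : exists g0 : 'M[C]_N, forall i j, ctends U (fun m => f m i j) (g0 i j).
  apply: (@ultra_ctends_mx _ _ _ _ _ _ _ B); apply: filterE => m i j.
  exact: BP.
have g0s : stabilizer act v g0.
  split.
    apply: (ctends_unique (ctends_det fg0)).
    by apply: eq_ctends (ctends_cst _) => m; have [-> _] := fs m.
  apply: (phi_inj rep) => i; apply: (ctends_unique (wr_ctends rep _ fg0 v i)).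
  by apply: eq_ctends (ctends_cst _) => m; have [_ ->] := fs m.
have g0u : g0 \in unitmx by apply: SL_unit; have [] := g0s.
have lim1 i j : ctends U (fun m => (invmx g0 *m f m) i j) ((1%:M : 'M[C]_N) i j).
  rewrite -(mulVmx g0u).
  by apply: (ctends_mulmx (fun _ _ => ctends_cst _) fg0).
have near1 : U [set m | forall ij, normc ((invmx g0 *m f m - 1%:M) ij.1 ij.2) < e].
  apply: filter_forall => -[i j] /=.
  have /ctendsP/(_ e e0) := lim1 i j.
  by apply: filterS => m /=; rewrite !mxE.
have ne : U [set m | f m != g0].
  have [[m0 fm0]|nex] := pselect (exists m0, f m0 = g0).
    apply: ooU; exists m0.+1 => // m /= hm; rewrite -fm0; apply/eqP => /finj mE.
    by rewrite mE ltnn in hm.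
  by apply: filterE => m; apply/eqP => fm; apply: nex; exists m.
have [m [m1 m2]] := filter_ex (filterI near1 ne).
exists (invmx g0 *m f m); split; last by move=> i j; exact: (m1 (i, j)).
  by apply: stabilizerM => //; exact: stabilizerV.
apply: contra m2 => /eqP h.
by rewrite -[f m]mul1mx -(mulmxV g0u) -mulmxA h mulmx1.
Qed.

(** Evaluate u (g - 1) = (a - 1) u at an entry of u of largest modulus. *)
Lemma eigenvalue_near1 g (u : 'rV[C]_N) (a : C) (e : R) : u != 0 -> u *m g = a *: u ->
  (forall i j, normc ((g - 1%:M) i j) < e) -> normc (a - 1) <= N%:R * e.
Proof.
move=> u0 ug ge.
have [j0 uj0] := row_neq0P u0.
have [j _ jmax] := @arg_maxP _ _ _ j0 xpredT (fun j => normc (u 0 j)) isT.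
have uj : 0 < normc (u 0 j).
  by apply: lt_le_trans (jmax j0 isT); rewrite normc_gt0.
rewrite -(ler_pM2r uj) -normcM.
have -> : (a - 1) * u 0 j = (u *m (g - 1%:M)) 0 j.
  by rewrite mulmxBr mulmx1 ug !mxE mulrBl mul1r.
rewrite (le_trans (normc_mulmx_le _ (fun i j => ltW (ge i j)) _))//.
rewrite mulrAC ler_wpM2r//; first by rewrite (le_trans _ (ltW (ge 0 0)))// normc_ge0.
have -> : N%:R * normc (u 0 j) = \sum_(i < N) normc (u 0 j).
  by rewrite sumr_const card_ord mulr_natl.
by apply: ler_sum => i _; exact: jmax.
Qed.

End ProperOrbits.

Section HilbertMumfordCriterion.
Variables (R : realType) (n : nat).
Local Notation C := R[i].
Local Notation N := n.+1.
Variables (W : vectType C) (act : 'M[C]_N -> W -> W) (I : finType).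
Variables (b : I -> W) (phi : I -> W -> C) (chi : I -> 'I_N -> nat).
Hypothesis rep : weight_rep act b phi chi.
Implicit Types (lam mu : 'rV[R]_N) (g h : 'M[C]_N) (v w : W).
Local Notation wt := (wt chi).

(** Some entry of lam is nonzero, and the corresponding diagonal entry of the
    ray takes all positive values. *)
Lemma conjugate_ray_unbounded (P : 'M[C]_N) lam (B : R) : P \in unitmx -> lam != 0 ->
  ~ forall s i j, normc ((invmx P *m torus (s *: lam) *m P) i j) <= B.
Proof.
move=> Pu /row_neq0P[j lj] fB.
pose K := (\sum_(i < N) (\sum_l normc (P j l)) * B) * (\sum_i \sum_l normc (invmx P i l)).
have expK t : expR t <= K.
  pose f := invmx P *m torus ((t / lam 0 j) *: lam) *m P.
  have -> : expR t = normc ((row j P *m f *m invmx P) 0 j).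
    rewrite /f -!row_mul mulmxA mulmxK// mulmxA mulmxV// mul1mx !mxE eqxx mulr1n.
    by rewrite divfK// normc_real ger0_norm ?expR_ge0.
  have entry i l : normc (invmx P i l) <= \sum_i \sum_l normc (invmx P i l).
    rewrite (bigD1 i)//= (bigD1 l)//= -addrA lerDl addr_ge0// sumr_ge0// => i' _.
      exact: normc_ge0.
    by apply: sumr_ge0 => l' _; exact: normc_ge0.
  rewrite (le_trans (normc_mulmx_le _ entry _))// ler_wpM2r//.
    by apply: sumr_ge0 => i _; apply: sumr_ge0 => l _; exact: normc_ge0.
  apply: ler_sum => i _; rewrite (le_trans (normc_mulmx_le _ (fB _) _))//.
  by under eq_bigr do rewrite mxE.
by have := expK K; have := expR_ge1Dx K; lra.
Qed.

(** An element of the stabilizer close to 1 has eigenvalues exp(i theta_j); the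
    smallness of theta, measured against all the exponents [chi], makes the
    real ray along theta stabilize v, which is impossible in a bounded group.
    *)
Lemma finite_stabilizer v : proper_orbit act phi v -> finite_set (stabilizer act v).
Proof.
move=> prop; apply: contrapT => inf.
(* D exceeds the sum of the exponents of every weight, and also N, the exponent
   sum of the determinant *)
pose D := (\sum_i \sum_j chi i j + N).+1.
pose eta : R := pi / D%:R.
have D0 : 0 < D%:R :> R by rewrite ltr0n.
have eta0 : 0 < eta by rewrite divr_gt0// pi_gt0.
have [delta delta0 deltaP] := small_angle eta0.
pose e := delta / N.+1%:R.
have e0 : 0 < e by rewrite divr_gt0.
have Ne : N%:R * e < delta.
  by rewrite /e mulrA ltr_pdivrMr ?ltr0n// mulrC ltr_pM2l// ltr_nat.
have [g [gs gn1 ge]] := infinite_stabilizer_near1 rep prop inf e0.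
have gu : g \in unitmx by apply: SL_unit; have [] := gs.
have [B BP] := stabilizer_bounded prop.
have [P [a [Pu Pg a1]]] : exists (P : 'M[C]_N) (a : 'rV[C]_N),
    [/\ P \in unitmx, P *m g = diag_mx a *m P & forall j, normc (a 0 j) = 1].
  apply: (@bounded_powers_diagonalizable _ _ _ B gu) => k i j; apply: BP.
    exact: (stabilizerX rep).
  by apply: (stabilizerX rep); exact: (stabilizerV rep).
have /choice[theta thetaP] : forall j, exists x : R, `|x| < eta /\ a 0 j = cis x.
  move=> j; have [||x x1 x2] := deltaP (a 0 j) => //; last by exists x.
  apply: le_lt_trans Ne.
  apply: (@eigenvalue_near1 _ _ g (row j P)) => //; first exact: row_unitmx_neq0.
  by rewrite -row_mul Pg row_mul row_diag_mx -scalemxAl -rowE.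
pose lam : 'rV[R]_N := \row_j theta j.
have small (c : 'I_N -> nat) : (\sum_j c j < D)%N ->
    cis (\sum_j theta j * (c j)%:R) = 1 -> \sum_j theta j * (c j)%:R = 0.
  move=> cD; apply: cis_eq1.
  rewrite (le_lt_trans (ler_norm_sum _ _ _))//.
  apply: (@le_lt_trans _ _ (eta * (\sum_j c j)%:R)).
    rewrite natr_sum mulr_sumr; apply: ler_sum => j _.
    by rewrite normrM normr_nat ler_wpM2r// ltW//; have [] := thetaP j.
  by rewrite /eta mulrAC ltr_pdivrMr// ltr_pM2l ?pi_gt0// ltr_nat.
have lams : \sum_j lam 0 j = 0.
  transitivity (\sum_j theta j * 1%:R); first by apply: eq_bigr => j _; rewrite mxE mulr1.
  apply: (small (fun=> 1%N)).
    by rewrite sum1_card card_ord /D ltnS leq_addl.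
  have : \det g = 1 by have [] := gs.
  have := congr1 determinant Pg; rewrite !det_mulmx mulrC => /mulIf ->; last first.
    by rewrite -unitfE -unitmxE.
  rewrite det_diag cis_sum => a1E; rewrite -[RHS]a1E; apply: eq_bigr => j _.
  by rewrite mulr1; have [_ ->] := thetaP j.
have lam0 : lam != 0.
  apply: contra gn1 => /eqP l0; apply/eqP.
  rewrite -[g](mulKmx Pu) Pg.
  have -> : diag_mx a = 1%:M.
    rewrite -diag_const_mx; congr diag_mx; apply/rowP => j; rewrite [RHS]mxE.
    have [_ ->] := thetaP j; have /rowP/(_ j) := l0; rewrite !mxE => ->.
    exact: cis0.
  by rewrite mul1mx mulVmx.
pose w := act P v.
have wfix : act (diag_mx a) w = w.
  by rewrite /w -(wr_actM rep) -Pg (wr_actM rep); have [_ ->] := gs.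
have wt0 i : phi i w != 0 -> wt lam i = 0.
  move=> pw; transitivity (\sum_j theta j * (chi i j)%:R).
    by apply: eq_bigr => j _; rewrite mxE.
  apply: small.
    by rewrite /D ltnS (bigD1 i)//= -addnA leq_addr.
  have := congr1 (phi i) wfix; rewrite (phi_diag rep) => h.
  rewrite cis_sum -[RHS](divff pw) -[X in X / _]h mulfK//.
  by apply: eq_bigr => j _; rewrite cis_natr; have [_ ->] := thetaP j.
have torus_fix (s : R) : act (torus (s *: lam)) w = w.
  apply: (phi_inj rep) => i; rewrite (phi_torus rep) wtZ.
  have [->|pw] := eqVneq (phi i w) 0; first by rewrite mulr0.
  by rewrite (wt0 i pw) mulr0 expR0 mul1r.
apply: (conjugate_ray_unbounded Pu lam0 (B := B)) => s; apply: BP; split.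
  rewrite /SL/= !det_mulmx det_inv mulrAC mulVf ?mul1r; last by rewrite -unitfE -unitmxE.
  by have := det_ray s (det1 _ _) lams; rewrite mulmx1.
by rewrite !(wr_actM rep) -/w torus_fix (act_invmxK rep).
Qed.

Lemma hilbert_mumford_stable v : v != 0 ->
  git_stable act v <-> ~ weakly_destabilized act phi chi v.
Proof.
move=> v0; split=> [vs /(weakly_destabilized_nonstable rep)//|/(properI rep) prop].
have cl := orbit_closed rep prop.
split => //; last exact: finite_stabilizer.
rewrite /git_semistable cl => -[g g1 gv]; move/eqP: v0; apply.
by rewrite -(act_invmxK rep v (SL_unit g1)) gv (act0 rep).
Qed.

End HilbertMumfordCriterion.

(** * The Cauchy-Binet formula *)

(** A permutation that contributes fixes every index except the one that it
    sends to i, hence all of them. *)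
Lemma det_replace_column (K : comNzRingType) m (B : 'M[K]_m) (i : 'I_m) :
  (forall i' j, j != i -> B i' j = (i' == j)%:R) -> \det B = B i i.
Proof.
move=> Bd; rewrite /determinant (bigD1 1%g)//= odd_perm1 mul1r.
rewrite (bigD1 i)//= perm1 big1 ?mulr1 => [|j ji]; last by rewrite perm1 Bd ?eqxx.
rewrite big1 ?addr0// => sg sg1.
have [j sj si] : exists2 j, sg j != j & sg j != i.
  have [j sj] : exists j, sg j != j.
    apply/existsP; rewrite -negb_forall; apply: contra sg1 => /forallP h.
    by apply/eqP/permP => j; rewrite perm1; apply/eqP.
  have [si|si] := eqVneq (sg j) i; last by exists j.
  have ji : j != i by rewrite -si eq_sym.
  have sii : sg i != i by rewrite -{2}si (inj_eq perm_inj) eq_sym.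
  by exists i.
by rewrite (bigD1 j)//= Bd// eq_sym (negPf sj) mul0r mulr0.
Qed.

Section CauchyBinet.
Variables (m p : nat).

(** For p = \dim {:V} this is convertible to [incr_index V m], so the formula
    below applies to the coordinates of [extpow]. *)
Definition incr := {s : m.-tuple 'I_p | sorted ltn [seq val i | i <- s]}.
HB.instance Definition _ := Finite.on incr.

Implicit Types s : incr.

Lemma incr_uniq s : uniq (val s).
Proof.
rewrite -(map_inj_uniq val_inj); apply: sorted_uniq (valP s).
  exact: ltn_trans.
exact: ltnn.
Qed.

Lemma incr_inj s : injective (tnth (val s)).
Proof. by apply/tuple_uniqP; exact: incr_uniq. Qed.

Lemma incr_eq s s' : val s =i val s' -> s = s'.
Proof.
move=> ss; apply/val_inj/val_inj/(inj_map val_inj).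
apply: (irr_sorted_eq ltn_trans ltnn (valP s) (valP s')) => k.
by apply/mapP/mapP => -[x xs ->]; exists x => //; rewrite ?ss// -?ss.
Qed.

(** An injection is an increasing one composed with a permutation: sort its
    values. *)
Lemma incr_perm (u : {ffun 'I_m -> 'I_p}) : injective u ->
  exists s, exists sg : 'S_m, forall i, u i = tnth (val s) (sg i).
Proof.
move=> ui; pose r := sort (relpre val leq) (codom u).
have rsz : size r == m by rewrite size_sort size_codom card_ord.
have rs : sorted ltn [seq val i | i <- Tuple rsz].
  rewrite ltn_sorted_uniq_leq /= map_inj_uniq; last exact: val_inj.
  rewrite sort_uniq; apply/andP; split; first exact/injectiveP.
  by rewrite sorted_map; apply: sort_sorted => x y; exact: leq_total.
exists (exist _ (Tuple rsz) rs).
have : perm_eq (codom u) (Tuple rsz) by rewrite perm_sym perm_sort.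
case/tuple_permP => sg E; exists sg => i /=.
have := congr1 (fun l => nth (u i) l i) E.
rewrite -tnth_nth tnth_mktuple => <-.
by rewrite /codom /image_mem (nth_map i) -?enumT ?size_enum_ord// nth_ord_enum.
Qed.

Variable K : comNzRingType.

Lemma det_incr_delta s s' :
  \det (\matrix_(i < m, j < m) (tnth (val s) j == tnth (val s') i)%:R) =
  (s == s')%:R :> K.
Proof.
have [->|ss] := eqVneq s s'.
  rewrite -[RHS](det1 _ m); congr determinant; apply/matrixP => i j.
  by rewrite !mxE (inj_eq (@incr_inj s')) eq_sym.
have [j js] : exists j, tnth (val s) j \notin val s'.
  apply/existsP; rewrite -negb_forall; apply: contra ss => /forallP h.
  apply/eqP/incr_eq; apply: (uniq_min_size (incr_uniq s) _ _).2.
    by move=> x /tnthP[j ->]; exact: h.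
  by rewrite !size_tuple.
rewrite /determinant big1// => sg _.
rewrite (bigD1 (sg^-1 j)%g)//= mxE permKV.
case: eqP => [E|_]; last by rewrite mul0r mulr0.
by rewrite E mem_tnth in js.
Qed.

Lemma det_mulmx_rowsub (A : 'M[K]_(m, p)) (B : 'M[K]_(p, m)) :
  \det (A *m B) =
  \sum_(u : {ffun 'I_m -> 'I_p}) (\prod_i A i (u i)) * \det (rowsub u B).
Proof.
transitivity (\sum_(sg : 'S_m) \sum_(u : {ffun 'I_m -> 'I_p})
    (-1) ^+ sg * \prod_i (A i (u i) * B (u i) (sg i))).
  apply: eq_bigr => sg _; rewrite -mulr_sumr; congr (_ * _).
  rewrite -(bigA_distr_bigA (fun i k => A i k * B k (sg i))).
  by apply: eq_bigr => i _; rewrite mxE.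
rewrite exchange_big; apply: eq_bigr => u _ /=.
rewrite mulr_sumr; apply: eq_bigr => sg _; rewrite big_split/= mulrCA.
by congr (_ * (_ * _)); apply: eq_bigr => i _; rewrite mxE.
Qed.

(** Expanding the product gives a sum over all maps u from rows to columns;
    those that are not injective contribute 0, and the others are grouped by
    their image. *)
Theorem cauchy_binet (A : 'M[K]_(m, p)) (B : 'M[K]_(p, m)) :
  \det (A *m B) =
  \sum_(s : incr) \det (colsub (tnth (val s)) A) * \det (rowsub (tnth (val s)) B).
Proof.
rewrite det_mulmx_rowsub (bigID (fun u : {ffun 'I_m -> 'I_p} => injectiveb u))/=.
rewrite [X in _ + X]big1 ?addr0 => [|u]; last first.
  move=> /injectivePn[i [j ij uij]].
  rewrite (determinant_alternate ij) ?mulr0// => k.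
  by rewrite !mxE uij.
pose h (x : incr * 'S_m) : {ffun 'I_m -> 'I_p} := [ffun i => tnth (val x.1) (x.2 i)].
have hinj : injective h.
  move=> [s sg] [s' sg'] /ffunP E.
  have ss : s = s'.
    apply: incr_eq => x; apply/tnthP/tnthP => -[j ->].
      by exists (sg' (sg^-1 j)%g); have := E (sg^-1 j)%g; rewrite !ffunE/= permKV.
    by exists (sg (sg'^-1 j)%g); have := E (sg'^-1 j)%g; rewrite !ffunE/= permKV.
  rewrite -ss in E *; congr (_, _); apply/permP => i.
  by apply: (@incr_inj s); have := E i; rewrite !ffunE.
rewrite (eq_bigl (mem (h @: [set: incr * 'S_m]%SET))) => [|u]; last first.
  apply/injectiveP/imsetP => [/incr_perm[s [sg E]]|[[s sg] _ ->]].
    by exists (s, sg); rewrite ?inE//; apply/ffunP => i; rewrite ffunE.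
  by move=> i j; rewrite !ffunE => /incr_inj/perm_inj.
rewrite big_imset /=; last by move=> x y _ _; exact: hinj.
rewrite (eq_bigl xpredT) => [|x]; last by rewrite inE.
rewrite -(pair_bigA _ (fun s sg => (\prod_i A i (h (s, sg) i)) * \det (rowsub (h (s, sg)) B)))/=.
apply: eq_bigr => s _; rewrite /(\det (colsub _ _)) mulr_suml.
apply: eq_bigr => sg _.
have -> : rowsub (h (s, sg)) B = row_perm sg (rowsub (tnth (val s)) B).
  by apply/matrixP => i j; rewrite !mxE ffunE.
rewrite row_permE det_mulmx det_perm mulrCA mulrA.
by congr (_ * _ * _); apply: eq_bigr => i _; rewrite mxE ffunE.
Qed.

End CauchyBinet.

(** * Exterior powers *)

Section ExteriorRep.
Variables (R : realType) (n : nat).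
Local Notation C := R[i].
Local Notation N := n.+1.
Variables (V : vectType C) (act : 'M[C]_N -> V -> V) (I : finType).
Variables (b : I -> V) (phi : I -> V -> C) (chi : I -> 'I_N -> nat).
Hypothesis rep : weight_rep act b phi chi.
Variable m : nat.
Local Notation e := (vbasis {:V}).
Implicit Types (f : 'I_m -> V) (w : extpow V m).

Lemma wedgeE f (s : incr_index V m) :
  wedge f s = \det (\matrix_(i < m, j < m) coords (f i) 0 (tnth (val s) j)).
Proof. by rewrite ffunE. Qed.

Lemma ext_scaleE (a : C) w s : (a *: w) s = a * w s.
Proof. by rewrite ffunE. Qed.

Lemma ext_sumE (J : finType) (c : J -> C) (u : J -> extpow V m) s :
  (\sum_j c j *: u j) s = \sum_j c j * u j s.
Proof. by rewrite sum_ffunE; apply: eq_bigr => j _; rewrite ext_scaleE. Qed.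

Lemma ext_addE w w' s : (w + w') s = w s + w' s.
Proof. by rewrite ffunE. Qed.

Lemma coordsP v : v = \sum_j coords v 0 j *: e`_j.
Proof.
rewrite {1}(coord_vbasis (memvf v)); apply: eq_bigr => j _.
by rewrite mxE.
Qed.

Lemma coords_basis (k l : 'I_(\dim {:V})) : coords e`_k 0 l = (l == k)%:R.
Proof. by rewrite mxE coord_free ?(basis_free (vbasisP _))// eq_sym. Qed.

Lemma coords_scalar j : scalar (fun v : V => coords v 0 j).
Proof. by move=> a u v; rewrite !mxE linearP. Qed.

(** The Cauchy-Binet formula in the coordinates of [extpow]; that [ext_map] and
    [ext_phi] have the expected values on wedge products are the two instances
    of it. *)
Lemma det_wedge (l : 'I_m -> V -> C) f : (forall j, scalar (l j)) ->
  \det (\matrix_(i < m, j < m) l j (f i)) =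
  \sum_(s : incr_index V m) wedge f s *
    \det (\matrix_(i < m, j < m) l j e`_(tnth (val s) i)).
Proof.
move=> ll; pose A := \matrix_(i < m, k < \dim {:V}) coords (f i) 0 k.
pose B := \matrix_(k < \dim {:V}, j < m) l j e`_k.
transitivity (\det (A *m B)).
  congr determinant; apply/matrixP => i j; rewrite !mxE {1}(coordsP (f i)).
  by rewrite (scalar_comb _ _ (ll j)); apply: eq_bigr => k _; rewrite !mxE.
rewrite cauchy_binet; apply: eq_bigr => s _.
by congr (_ * _); rewrite ?wedgeE; congr determinant;
  apply/matrixP => i j; rewrite [LHS]mxE [RHS]mxE mxE.
Qed.

Lemma wedge_basis (s s' : incr_index V m) :
  wedge (fun i => e`_(tnth (val s') i)) s = (s == s')%:R.
Proof.
rewrite wedgeE -(det_incr_delta _ s s'); congr determinant.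
by apply/matrixP => i j; rewrite [LHS]mxE [RHS]mxE coords_basis.
Qed.

Lemma extpow_span w : w = \sum_s w s *: wedge (fun i => e`_(tnth (val s) i)).
Proof.
apply/ffunP => s; rewrite ext_sumE (bigD1 s)//= big1 ?addr0 => [|s' ss'].
  by rewrite wedge_basis eqxx mulr1.
by rewrite wedge_basis eq_sym (negPf ss') mulr0.
Qed.

Lemma ext_map_linear (A : V -> V) : linear (@ext_map C V m A).
Proof.
move=> a w w'; rewrite /ext_map scaler_sumr -big_split; apply: eq_bigr => s _ /=.
by rewrite scalerA -scalerDl ext_addE ext_scaleE.
Qed.

Lemma ext_map_wedge (A : V -> V) f : linear A ->
  ext_map A (wedge f) = wedge (fun i => A (f i)).
Proof.
move=> Al; apply/ffunP => s; rewrite [LHS]ext_sumE [RHS]wedgeE.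
rewrite (det_wedge (l := fun j v => coords (A v) 0 (tnth (val s) j))) => [|j a u v].
  by apply: eq_bigr => s' _; congr (_ * _); exact: wedgeE.
by rewrite Al coords_scalar.
Qed.

Lemma wedgeZ (c : 'I_m -> C) f :
  wedge (fun i => c i *: f i) = (\prod_i c i) *: wedge f.
Proof.
apply/ffunP => s; rewrite [LHS]wedgeE [RHS]ext_scaleE.
rewrite [X in _ = _ * X]wedgeE.
have -> : \matrix_(i < m, j < m) coords (c i *: f i) 0 (tnth (val s) j) =
    diag_mx (\row_i c i) *m \matrix_(i < m, j < m) coords (f i) 0 (tnth (val s) j).
  by apply/matrixP => i j; rewrite mul_diag_mx !mxE linearZ.
rewrite det_mulmx det_diag; congr (_ * _).
by apply: eq_bigr => i _; rewrite mxE.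
Qed.

Definition ext_idx (s : incr m #|I|) (j : 'I_m) : I := enum_val (tnth (val s) j).

Definition ext_basis (s : incr m #|I|) : extpow V m := wedge (fun j => b (ext_idx s j)).

Definition ext_coef (s : incr m #|I|) (f : 'I_m -> V) : C :=
  \det (\matrix_(i < m, j < m) phi (ext_idx s j) (f i)).

Definition ext_phi (s : incr m #|I|) w : C :=
  \sum_s' w s' * ext_coef s (fun i => e`_(tnth (val s') i)).

Definition ext_chi (s : incr m #|I|) (l : 'I_N) : nat := (\sum_j chi (ext_idx s j) l)%N.

Lemma ext_phi_wedge s f : ext_phi s (wedge f) = ext_coef s f.
Proof.
by rewrite [RHS](@det_wedge (fun j => phi (ext_idx s j)))// => j; exact: wr_phi_linear rep _.
Qed.

Lemma wedge_span f : wedge f = \sum_s ext_coef s f *: ext_basis s.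
Proof.
apply/ffunP => s'; rewrite [LHS]wedgeE [RHS]ext_sumE.
pose A := \matrix_(i < m, k < #|I|) phi (enum_val k) (f i).
pose B := \matrix_(k < #|I|, j < m) coords (b (enum_val k)) 0 (tnth (val s') j).
transitivity (\det (A *m B)).
  congr determinant; apply/matrixP => i j; rewrite [LHS]mxE [RHS]mxE.
  rewrite {1}(wr_phi_span rep (f i)).
  rewrite (scalar_comb _ _ (coords_scalar _)) (reindex (@enum_val I I)) /=.
    by apply: eq_bigr => k _; rewrite !mxE.
  by apply: onW_bij; exact: enum_val_bij.
rewrite cauchy_binet; apply: eq_bigr => s _; rewrite [X in _ = _ * X]wedgeE.
by congr (_ * _); congr determinant; apply/matrixP => i j; rewrite [LHS]mxE [RHS]mxE mxE.
Qed.

Lemma ext_phi_linear s : scalar (ext_phi s).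
Proof.
move=> a w w'; rewrite /ext_phi mulr_sumr -big_split; apply: eq_bigr => s' _ /=.
by rewrite ext_addE ext_scaleE mulrA -mulrDl.
Qed.

(** The wedge products of weight vectors are weight vectors, and their
    coordinates are the minors of the coordinates of V. *)
Lemma ext_rep : weight_rep (fun g => @ext_map C V m (act g)) ext_basis ext_phi ext_chi.
Proof.
split.
- by move=> g; exact: ext_map_linear.
- move=> w; rewrite /ext_map [RHS]extpow_span; apply: eq_bigr => s _.
  by congr (_ *: wedge _); apply/funext => i; rewrite (wr_act1 rep).
- move=> g h w; rewrite {1}/ext_map [X in ext_map _ X]/ext_map.
  rewrite (linear_comb _ _ (@ext_map_linear (act g))); apply: eq_bigr => s _.
  rewrite ext_map_wedge; last exact: wr_linear rep _.
  by congr (_ *: wedge _); apply/funext => i; rewrite (wr_actM rep).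
- exact: ext_phi_linear.
- move=> s s'; rewrite ext_phi_wedge -(det_incr_delta _ s s').
  congr determinant; apply/matrixP => i j; rewrite !mxE (wr_phi_basis rep).
  by rewrite (inj_eq enum_val_inj).
- move=> w; rewrite {1}(extpow_span w).
  under eq_bigr do rewrite wedge_span scaler_sumr.
  rewrite exchange_big; apply: eq_bigr => s _.
  by rewrite /ext_phi scaler_suml; apply: eq_bigr => s' _; rewrite scalerA.
- move=> t s; rewrite ext_map_wedge; last exact: wr_linear rep _.
  transitivity (wedge (fun i => (\prod_j t 0 j ^+ chi (ext_idx s i) j) *: b (ext_idx s i))).
    by congr wedge; apply/funext => i; rewrite (wr_diag rep).
  rewrite wedgeZ; congr (_ *: _); rewrite exchange_big; apply: eq_bigr => j _.
  by rewrite prodrXr.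
- move=> F FF g g0 gg0 w s.
  have phiE h : ext_phi s (ext_map (act h) w) =
      \sum_s' w s' * ext_coef s (fun i => act h e`_(tnth (val s') i)).
    rewrite /ext_map (scalar_comb _ _ (ext_phi_linear s)).
    by apply: eq_bigr => s' _; rewrite ext_phi_wedge.
  have lim : ctends F (fun x => \sum_s' w s' *
      ext_coef s (fun i => act (g x) e`_(tnth (val s') i)))
      (\sum_s' w s' * ext_coef s (fun i => act g0 e`_(tnth (val s') i))).
    apply: ctends_sum => s' _; apply: ctendsM (ctends_cst _) _.
    apply: ctends_det => i j; rewrite mxE.
    apply: eq_ctends (wr_ctends rep _ gg0 _ _) => x.
    by rewrite mxE.
  exact: ctends_congr (fun x => phiE (g x)) (phiE g0) lim.
Qed.

End ExteriorRep.

(** * Homogeneous polynomials *)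

Section LinearSubstitution.
Variables (K : numFieldType) (n : nat).
Implicit Types (g h : 'M[K]_n.+1) (f p : mpoly n.+1 K).

Lemma lin_substX g i : lin_subst g (mpolyX K (mnm1 i)) = lin_form g i.
Proof. by rewrite /lin_subst comp_mpolyXU -tnth_nth tnth_mktuple. Qed.

Lemma lin_subst_monomial g (m : multinom n.+1) :
  lin_subst g (mpolyX K m) = \prod_i lin_form g i ^+ m i.
Proof.
by rewrite /lin_subst comp_mpolyX; apply: eq_bigr => i _; rewrite tnth_mktuple.
Qed.

Lemma lin_subst_prod g (J : finType) (F : J -> mpoly n.+1 K) :
  lin_subst g (\prod_j F j) = \prod_j lin_subst g (F j).
Proof. exact: rmorph_prod. Qed.

Lemma lin_substE g f :
  lin_subst g f = \sum_(m <- msupp f) mcoeff m f *: lin_subst g (mpolyX K m).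
Proof. exact: comp_mpolyEX. Qed.

Lemma lin_subst_comb g (J : Type) (r : seq J) (c : J -> K) (F : J -> mpoly n.+1 K) :
  lin_subst g (\sum_(j <- r) c j *: F j) = \sum_(j <- r) c j *: lin_subst g (F j).
Proof.
by rewrite /lin_subst raddf_sum; apply: eq_bigr => j _; exact: comp_mpolyZ.
Qed.

(** Both sides are algebra morphisms in f, so it is enough to compare them on
    the variables. *)
Lemma lin_substM g h f : lin_subst g (lin_subst h f) = lin_subst (g *m h) f.
Proof.
rewrite (lin_substE h) (lin_substE (g *m h)) lin_subst_comb.
apply: eq_bigr => m _; congr (_ *: _).
rewrite !lin_subst_monomial lin_subst_prod.
apply: eq_bigr => j _; rewrite [LHS]rmorphXn; congr (_ ^+ _).
rewrite [LHS]lin_subst_comb; under eq_bigr => i _ do rewrite lin_substX scaler_sumr.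
rewrite exchange_big; apply: eq_bigr => k _ /=.
rewrite mxE scaler_suml; apply: eq_bigr => i _.
by rewrite scalerA mulrC.
Qed.

Lemma lin_form1 (i : 'I_n.+1) : lin_form (1%:M : 'M[K]_n.+1) i = mpolyX K (mnm1 i).
Proof.
rewrite /lin_form (bigD1 i)//= mxE eqxx scale1r big1 ?addr0// => j ji.
by rewrite mxE (negPf ji) scale0r.
Qed.

Lemma lin_subst1 f : lin_subst 1%:M f = f.
Proof.
rewrite lin_substE [RHS](mpolyE f); apply: eq_bigr => m _; congr (_ *: _).
rewrite lin_subst_monomial [RHS]mpolyXE_id.
by apply: eq_bigr => i _; rewrite lin_form1.
Qed.

Lemma lin_subst_diag (t : 'rV[K]_n.+1) (m : multinom n.+1) :
  lin_subst (diag_mx t) (mpolyX K m) = (\prod_j t 0 j ^+ m j) *: mpolyX K m.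
Proof.
rewrite lin_subst_monomial [in RHS]mpolyXE_id -scaler_prod; apply: eq_bigr => j _.
rewrite -exprZn; congr (_ ^+ _).
rewrite /lin_form (bigD1 j)//= mxE eqxx mulr1n big1 ?addr0// => i ij.
by rewrite mxE (negPf ij) mulr0n scale0r.
Qed.

Lemma hs_act_linear d g : linear (@hs_act K n d g).
Proof.
move=> a u v; apply/val_inj; rewrite /= /lin_subst comp_mpolyD comp_mpolyZ.
by [].
Qed.

End LinearSubstitution.

Section PolynomialLimits.
Variables (R : realType) (n : nat) (T : Type) (F : set_system T).
Context {FF : ProperFilter F}.
Local Notation C := R[i].

Definition mtends (f : T -> mpoly n.+1 C) (l : mpoly n.+1 C) : Prop :=
  forall m, ctends F (fun x => mcoeff m (f x)) (mcoeff m l).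

Lemma mtends_cst l : mtends (fun=> l) l.
Proof. by move=> m; exact: ctends_cst. Qed.

Lemma mtendsM f g k l : mtends f k -> mtends g l ->
  mtends (fun x => f x * g x) (k * l).
Proof.
move=> fk gl m; rewrite mcoeffM; under eq_fun do rewrite mcoeffM.
by apply: ctends_sum => ij _; apply: ctendsM; [exact: fk|exact: gl].
Qed.

Lemma mtends_prod (J : Type) (r : seq J) (f : J -> T -> mpoly n.+1 C) l :
    (forall j, mtends (f j) (l j)) ->
  mtends (fun x => \prod_(j <- r) f j x) (\prod_(j <- r) l j).
Proof.
move=> fl; elim: r => [|j r IH] m.
  rewrite big_nil; apply: eq_ctends (mtends_cst 1 m) => x.
  by rewrite big_nil.
rewrite big_cons; apply: eq_ctends (mtendsM (fl j) IH m) => x.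
by rewrite big_cons.
Qed.

Lemma mtendsX f l k : mtends f l -> mtends (fun x => f x ^+ k) (l ^+ k).
Proof.
move=> fl; elim: k => [|k IH] m.
  by rewrite expr0; exact: mtends_cst.
rewrite exprS; apply: eq_ctends (mtendsM fl IH m) => x.
by rewrite exprS.
Qed.

(** The coefficients of f(x g) are polynomials in the entries of g. *)
Lemma mtends_lin_subst (g : T -> 'M[C]_n.+1) (g0 : 'M[C]_n.+1) f :
    (forall i j, ctends F (fun x => g x i j) (g0 i j)) ->
  mtends (fun x => lin_subst (g x) f) (lin_subst g0 f).
Proof.
move=> gg0.
have form_lim i : mtends (fun x => lin_form (g x) i) (lin_form g0 i).
  move=> m; have E h : mcoeff m (lin_form h i) =
      \sum_j h j i * mcoeff m (mpolyX C (mnm1 j)).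
    by rewrite /lin_form raddf_sum; apply: eq_bigr => j _; exact: mcoeffZ.
  have lim : ctends F (fun x => \sum_j g x j i * mcoeff m (mpolyX C (mnm1 j)))
      (\sum_j g0 j i * mcoeff m (mpolyX C (mnm1 j))).
    by apply: ctends_sum => j _; exact: (ctendsM (gg0 j i) (ctends_cst _)).
  exact: ctends_congr (fun x => E (g x)) (E g0) lim.
move=> m; have E h : mcoeff m (lin_subst h f) =
    \sum_(m' <- msupp f) mcoeff m' f * mcoeff m (\prod_i lin_form h i ^+ m' i).
  rewrite lin_substE raddf_sum /=; apply: eq_bigr => m' _.
  by rewrite mcoeffZ lin_subst_monomial.
have lim : ctends F
    (fun x => \sum_(m' <- msupp f) mcoeff m' f * mcoeff m (\prod_i lin_form (g x) i ^+ m' i))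
    (\sum_(m' <- msupp f) mcoeff m' f * mcoeff m (\prod_i lin_form g0 i ^+ m' i)).
  apply: ctends_sum => m' _; apply: ctendsM (ctends_cst _) _.
  by apply: mtends_prod => i; apply: mtendsX; exact: form_lim.
exact: ctends_congr (fun x => E (g x)) (E g0) lim.
Qed.

End PolynomialLimits.

Section HomogeneousRep.
Variables (R : realType) (n d : nat).
Local Notation C := R[i].
Local Notation N := n.+1.

Definition hmon := {m : bmultinom N d.+1 | mdeg (bmnm m) == d}.
HB.instance Definition _ := Finite.on hmon.

Definition hmon_exp (i : hmon) : multinom N := bmnm (val i).

Lemma hmon_exp_inj : injective hmon_exp.
Proof. by move=> i j ij; apply/val_inj/val_inj. Qed.

Lemma hmonP (m : multinom N) : mdeg m = d -> exists i, hmon_exp i = m.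
Proof.
move=> md; have mb : (mdeg m < d.+1)%N by rewrite md.
have mi : mdeg (bmnm (BMultinom mb)) == d by rewrite /= md.
by exists (exist _ (BMultinom mb) mi).
Qed.

Lemma hmon_homog (i : hmon) : mpolyX C (hmon_exp i) \is ishomog1 d mdeg.
Proof. by rewrite dhomogX; exact: valP i. Qed.

Definition hs_basis (i : hmon) : dhomog N C d := DHomog (hmon_homog i).

Definition hs_coef (i : hmon) (f : dhomog N C d) : C := mcoeff (hmon_exp i) (val f).

Definition hs_chi (i : hmon) (j : 'I_N) : nat := hmon_exp i j.

Lemma val_hs_sum (J : Type) (r : seq J) (P : pred J) (F : J -> dhomog N C d) :
  val (\sum_(j <- r | P j) F j) = \sum_(j <- r | P j) val (F j).
Proof. exact: (big_morph (@mpoly_of_dhomog N C d)). Qed.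

Lemma hs_rep : weight_rep (@hs_act C n d) hs_basis hs_coef hs_chi.
Proof.
split.
- by move=> g; exact: hs_act_linear.
- by move=> f; apply/val_inj; exact: lin_subst1.
- by move=> g h f; apply/val_inj; rewrite /= lin_substM.
- by move=> i a f h; rewrite /hs_coef mcoeffD mcoeffZ.
- move=> i j; rewrite /hs_coef mcoeffX (inj_eq hmon_exp_inj).
  by rewrite eq_sym.
- move=> f; apply/val_inj; rewrite val_hs_sum; apply/mpolyP => m.
  rewrite raddf_sum /=; have [md|md] := eqVneq (mdeg m) d.
    have [i <-] := hmonP md.
    rewrite (bigD1 i)//= mcoeffZ mcoeffX eqxx mulr1 big1 ?addr0// => j ji.
    by rewrite mcoeffZ mcoeffX (inj_eq hmon_exp_inj) (negPf ji) mulr0.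
  rewrite (dhomog_nemf_coeff (dhomog_is_dhomog f) md) big1// => j _.
  rewrite mcoeffZ mcoeffX; case: eqP => [jm|_]; last by rewrite mulr0.
  by move: md; rewrite -jm (eqP (valP j)) eqxx.
- by move=> t i; apply/val_inj; exact: lin_subst_diag.
- move=> F FF g g0 gg0 f i; exact: mtends_lin_subst.
Qed.

End HomogeneousRep.

(** * Minors of least weight *)

Section MinimalMinor.
Variables (R : realType) (V : lmodType R[i]) (I : finType) (phi : I -> V -> R[i]).
Hypothesis phi_linear : forall i, scalar (phi i).
Variables (m : nat) (omega : I -> R).
Local Notation C := R[i].
Implicit Types (G : 'I_m -> V) (u : 'I_m -> I) (M : 'M[C]_m).

(** The columns [u] are an arbitrary family, so that minimizing over them does
    not involve any order on the index type. *)
Definition minor u G : C := \det (\matrix_(i < m, j < m) phi (u j) (G i)).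

Definition combine M G : 'I_m -> V := fun i => \sum_l M i l *: G l.

Lemma combine1 G : combine (1%:M : 'M[C]_m) G = G.
Proof.
apply/funext => i; rewrite /combine (bigD1 i)//= mxE eqxx scale1r.
by rewrite big1 ?addr0// => j ji; rewrite mxE eq_sym (negPf ji) scale0r.
Qed.

Lemma combineM M M' G :
  combine M (combine M' G) = combine (M *m M') G.
Proof.
apply/funext => i; rewrite /combine.
under eq_bigr => l _ do rewrite scaler_sumr.
rewrite exchange_big; apply: eq_bigr => j _ /=.
by rewrite mxE scaler_suml; apply: eq_bigr => l _; rewrite scalerA.
Qed.

Lemma minor_combine u M G : minor u (combine M G) = \det M * minor u G.
Proof.
rewrite -det_mulmx; congr determinant; apply/matrixP => i j.
rewrite [LHS]mxE [RHS]mxE (scalar_comb _ _ (phi_linear _)).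
by apply: eq_bigr => l _; rewrite mxE.
Qed.

Lemma minor_inj u G : minor u G != 0 -> injective u.
Proof.
move=> uG i j uij; apply: contraNeq uG => ij.
rewrite /minor -det_tr (determinant_alternate ij)// => l.
by rewrite !mxE uij.
Qed.

(** Choose u with nonzero minor and least total weight, and multiply G by the
    inverse of that block, which makes the block the identity.  If the i-th
    vector had a coordinate x lighter than u i, exchanging u i for x would give
    a nonzero minor of smaller weight. *)
Lemma echelon_basis G (u0 : 'I_m -> I) : minor u0 G != 0 ->
  exists (M : 'M[C]_m) (u : 'I_m -> I),
    [/\ \det M != 0, minor u G != 0 &
        forall i x, phi x (combine M G i) != 0 -> omega (u i) <= omega x].
Proof.
move=> u0G.
have u0G' : minor (finfun u0) G != 0.
  apply: contra u0G => /eqP <-; apply/eqP; congr determinant.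
  by apply/matrixP => i j; rewrite !mxE ffunE.
have [u uG umin] := @arg_minP _ _ {ffun 'I_m -> I} (finfun u0)
  (fun u : {ffun 'I_m -> I} => minor u G != 0)
  (fun u : {ffun 'I_m -> I} => \sum_j omega (u j)) u0G'.
pose A := \matrix_(i < m, j < m) phi (u j) (G i).
have Au : A \in unitmx by rewrite unitmxE unitfE.
exists (invmx A), u; split => //; first by rewrite -unitfE -unitmxE unitmx_inv.
move=> i x xF; rewrite leNgt; apply/negP => wlt.
pose u' : {ffun 'I_m -> I} := [ffun j => if j == i then x else u j].
have u'G : minor u' G != 0.
  have : minor u' (combine (invmx A) G) != 0.
    rewrite /minor (@det_replace_column _ _ _ i) => [|i' j ji].
      by rewrite mxE ffunE eqxx.
    rewrite mxE ffunE (negPf ji) (scalar_comb _ _ (phi_linear _)).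
    transitivity ((invmx A *m A) i' j); last by rewrite mulVmx// mxE.
    by rewrite mxE; apply: eq_bigr => l _; rewrite [A _ _]mxE.
  by rewrite minor_combine mulf_eq0 negb_or => /andP[].
have := umin _ u'G; rewrite leNgt => /negP; apply.
rewrite (bigD1 i)//= [ltRHS](bigD1 i)//= ffunE eqxx.
rewrite (eq_bigr (fun j => omega (u j))) => [|j ji]; last by rewrite ffunE (negPf ji).
by rewrite ltrD2r.
Qed.

(** Putting the columns in increasing order changes a minor by a sign only. *)
Lemma minor_sorted u G : minor u G != 0 ->
  exists s : incr m #|I|,
    minor (fun j => enum_val (tnth (val s) j)) G != 0 /\
    \sum_j omega (enum_val (tnth (val s) j)) = \sum_j omega (u j).
Proof.
move=> uG; have ui := minor_inj uG.
have [|s [sg sE]] := @incr_perm m #|I| [ffun j => enum_rank (u j)].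
  by move=> i j; rewrite !ffunE => /enum_rank_inj/ui.
have uE j : u j = enum_val (tnth (val s) (sg j)).
  by rewrite -sE ffunE enum_rankK.
exists s; split.
  apply: contra uG => /eqP s0; apply/eqP.
  pose B := \matrix_(i < m, j < m) phi (enum_val (tnth (val s) j)) (G i).
  rewrite /minor (_ : \matrix_(i, j) _ = col_perm sg B).
    by rewrite col_permE det_mulmx [\det B]s0 mul0r.
  by apply/matrixP => i j; rewrite !mxE uE.
rewrite [LHS](reindex_inj (@perm_inj _ sg)).
by apply: eq_bigr => j _; rewrite uE.
Qed.

End MinimalMinor.

(** * Weights of polynomials *)

Section WeightOfPolynomials.
Variables (K : numFieldType) (R : realType) (n : nat) (lam : 'rV[R]_n.+1).
Implicit Types (p q : mpoly n.+1 K) (m : multinom n.+1) (w : R).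

Definition mwt m : R := \sum_j lam 0 j * (m j)%:R.

Lemma mwtD m1 m2 : mwt (mnm_add m1 m2) = mwt m1 + mwt m2.
Proof.
rewrite /mwt -big_split; apply: eq_bigr => j _.
by rewrite mnmDE natrD mulrDr.
Qed.

Lemma mwt0 : mwt mnm0 = 0.
Proof. by rewrite /mwt big1// => j _; rewrite mnm0E mulr0. Qed.

Lemma msuppM_wt (a a' : pred R) (c : pred R) p q :
    (forall x y, a x -> a' y -> c (x + y)) ->
    (forall m, m \in msupp p -> a (mwt m)) -> (forall m, m \in msupp q -> a' (mwt m)) ->
  forall m, m \in msupp (p * q) -> c (mwt m).
Proof.
move=> ac pa qa m /msuppM_le/allpairsP[[m1 m2] /= [h1 h2 ->]].
by rewrite mwtD; apply: ac; [exact: pa|exact: qa].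
Qed.

Definition wt_ge p w := forall m, m \in msupp p -> w <= mwt m.

Lemma wt_ge_prod (J : finType) (F : J -> mpoly n.+1 K) (w : J -> R) :
  (forall j, wt_ge (F j) (w j)) -> wt_ge (\prod_j F j) (\sum_j w j).
Proof.
move=> Fw; elim/big_rec2: _ => [m|j p q _ qp].
  by rewrite msupp1 inE => /eqP ->; rewrite mwt0.
apply: (@msuppM_wt (>= w j) (>= p) (>= (w j + p))) => [x y||].
- exact: lerD.
- exact: Fw.
exact: qp.
Qed.

(** The part p0 of least weight is required to be nonzero and is kept apart
    from the rest, so that products can be computed on initial parts. *)
Definition initial_weight p w := exists p0 p1 : mpoly n.+1 K,
  [/\ p = p0 + p1, p0 != 0, forall m, m \in msupp p0 -> mwt m == w
    & forall m, m \in msupp p1 -> w < mwt m].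

Lemma initial_weight1 : initial_weight 1 0.
Proof.
exists 1, 0; split; rewrite ?addr0 ?oner_eq0// => m.
  by rewrite msupp1 inE => /eqP ->; rewrite mwt0.
by rewrite msupp0.
Qed.

(** The product of the initial parts is nonzero because polynomials over a
    field form a domain. *)
Lemma initial_weightM p q w w' :
  initial_weight p w -> initial_weight q w' -> initial_weight (p * q) (w + w').
Proof.
move=> [p0 [p1 [-> p0n p0w p1w]]] [q0 [q1 [-> q0n q0w q1w]]].
exists (p0 * q0), (p0 * q1 + p1 * (q0 + q1)); split.
- by rewrite mulrDl mulrDr addrA.
- by rewrite mulf_neq0.
- apply: (@msuppM_wt (pred1 w) (pred1 w') (pred1 (w + w'))) => // x y.
  by move=> /eqP -> /eqP ->; rewrite /= eqxx.
move=> m /msuppD_le; rewrite mem_cat => /orP[]; move: m.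
  apply: (@msuppM_wt (pred1 w) (> w') (> (w + w'))) => // x y /eqP -> /=.
  by rewrite ltrD2l.
apply: (@msuppM_wt (> w) (>= w') (> (w + w'))) => // [x y|m /msuppD_le].
  exact: ltr_leD.
by rewrite mem_cat => /orP[/q0w/eqP ->//|/q1w/ltW].
Qed.

Lemma initial_weight_prod (J : finType) (F : J -> mpoly n.+1 K) (w : J -> R) :
  (forall j, initial_weight (F j) (w j)) ->
  initial_weight (\prod_j F j) (\sum_j w j).
Proof.
move=> Fw; elim/big_rec2: _ => [|j p q _ qp]; first exact: initial_weight1.
exact: initial_weightM.
Qed.

Lemma initial_weight_mem p w : initial_weight p w ->
  exists2 m, m \in msupp p & mwt m = w.
Proof.
move=> [p0 [p1 [-> p0n p0w p1w]]].
have mm := mlead_supp p0n; exists (mlead p0); last exact/eqP/p0w.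
rewrite mcoeff_msupp mcoeffD.
have -> : mcoeff (mlead p0) p1 = 0.
  apply/eqP; rewrite mcoeff_eq0; apply/negP => /p1w.
  by rewrite (eqP (p0w _ mm)) ltxx.
by rewrite addr0 -mcoeff_msupp.
Qed.

Lemma seq_argmin (T : eqType) (f : T -> R) (s : seq T) (x : T) : x \in s ->
  exists2 y, y \in s & forall z, z \in s -> f y <= f z.
Proof.
elim: s x => // a s IH x _; have [->|] := eqVneq s [::].
  by exists a; rewrite ?mem_head// => z; rewrite inE => /eqP ->.
case: s IH => // c s IH _; have [y ys ymin] := IH c (mem_head _ _).
have [ay|ya] := leP (f a) (f y).
  exists a; first exact: mem_head.
  by move=> z; rewrite inE => /orP[/eqP ->//|/ymin]; exact: le_trans.
exists y; first by rewrite inE ys orbT.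
by move=> z; rewrite inE => /orP[/eqP ->|/ymin//]; exact: ltW.
Qed.

Lemma initial_weight_exists p : p != 0 ->
  exists2 w, initial_weight p w & wt_ge p w.
Proof.
move=> p0; have [m0 m0p m0min] := seq_argmin mwt (mlead_supp p0).
exists (mwt m0) => //.
pose part (a : pred (multinom n.+1)) :=
  \sum_(m <- msupp p | a m) mcoeff m p *: mpolyX K m.
have partE a m : mcoeff m (part a) = if a m then mcoeff m p else 0.
  rewrite /part raddf_sum /= big_mkcond /=.
  have [mp|mp] := boolP (m \in msupp p).
    rewrite (bigD1_seq m) ?msupp_uniq//= big1 => [|m' m'm].
      by rewrite addr0; case: ifP => //; rewrite mcoeffZ mcoeffX eqxx mulr1.
    by case: ifP => // _; rewrite mcoeffZ mcoeffX (negPf m'm) mulr0.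
  rewrite big_seq big1 => [|m' m'p].
    by rewrite (memN_msupp_eq0 mp); case: ifP.
  case: ifP => // _; rewrite mcoeffZ mcoeffX.
  by case: eqP => [m'm|_]; [rewrite -m'm m'p in mp|rewrite mulr0].
exists (part (fun m => mwt m == mwt m0)), (part (fun m => mwt m != mwt m0)).
split.
- by apply/mpolyP => m; rewrite mcoeffD !partE; case: eqP; rewrite ?addr0 ?add0r.
- apply/eqP => /mpolyP/(_ m0); rewrite partE eqxx mcoeff0 => /eqP.
  by rewrite mcoeff_eq0 m0p.
- by move=> m; rewrite mcoeff_msupp partE; case: ifP => //; rewrite eqxx.
move=> m; rewrite mcoeff_msupp partE; case: ifP; last by rewrite eqxx.
move=> mm; rewrite -mcoeff_msupp => /m0min.
by rewrite le_eqVlt eq_sym (negPf mm).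
Qed.

End WeightOfPolynomials.

(** * Weights of products and of Pluecker coordinates *)

Section LinearSystems.
Variables (R : realType) (n d k : nat).
Local Notation C := R[i].
Local Notation N := n.+1.
Local Notation m := k.+1.
Local Notation V := (dhomog N C d).
Implicit Types (h : 'M[C]_N) (lam : 'rV[R]_N) (G : 'I_m -> V).

Local Notation coef := (@hs_coef R n d).
Local Notation wtV := (wt (@hs_chi n d)).
Local Notation wtS := (wt (@hs_chi n (d * m))).
Local Notation wtL := (wt (ext_chi (@hs_chi n d) (m := m))).

Lemma wt_ext lam s : wtL lam s = \sum_j wtV lam (ext_idx s j).
Proof.
rewrite /wt exchange_big; apply: eq_bigr => l _ /=.
by rewrite -mulr_sumr -natr_sum.
Qed.

Lemma minor_neq0_perm u G : minor coef u G != 0 ->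
  exists sg : 'S_m, forall i, coef (u (sg i)) (G i) != 0.
Proof.
move=> uG; apply: contrapT => /forallNP nsg; move/eqP: uG; apply.
apply: big1 => sg _; have /existsNP[i /negP] := nsg sg.
rewrite negbK => /eqP ci.
by rewrite (bigD1 i)//= mxE ci mul0r mulr0.
Qed.

Lemma minor_wt_ge lam G (w : 'I_m -> R) u : (forall i, wt_ge lam (val (G i)) (w i)) ->
  minor coef u G != 0 -> \sum_i w i <= \sum_j wtV lam (u j).
Proof.
move=> Gw /minor_neq0_perm[sg sgP].
rewrite [leRHS](reindex_inj (@perm_inj _ sg)); apply: ler_sum => i _.
by apply: Gw; rewrite mcoeff_msupp; exact: sgP.
Qed.

(** [P] is either positivity or nonnegativity.  A nonzero minor contains a
    nonzero product of coefficients, one for each G i, so its weight is at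
    least the sum of the least weights of the G i, and that sum is the weight
    of a monomial of the product. *)
Lemma sum_wt_wedge_wt (P : R -> Prop) lam G :
    (forall x y, x <= y -> P x -> P y) -> (forall i, G i != 0) ->
    (forall i, hs_coef i (hs_sum G) != 0 -> P (wtS lam i)) ->
  forall s, ext_coef coef s G != 0 -> P (wtL lam s).
Proof.
move=> Pup G0 GP s sG.
have /choice[w wP] : forall i, exists w,
    initial_weight lam (val (G i)) w /\ wt_ge lam (val (G i)) w.
  move=> i; have [|w w1 w2] := @initial_weight_exists _ _ _ lam (val (G i)); last by exists w.
  by apply: contra (G0 i) => /eqP Gi; apply/eqP/val_inj.
have [mon monG monw] := initial_weight_mem (initial_weight_prod (fun i => (wP i).1)).
have [i iE] : exists i : hmon n (d * m), hmon_exp i = mon.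
  apply: hmonP; exact: (dhomog_mf (dhomog_is_dhomog (hs_sum G)) monG).
have iG : hs_coef i (hs_sum G) != 0.
  by rewrite /hs_coef iE -mcoeff_msupp.
apply: Pup (GP i iG); rewrite wt_ext.
have -> : wtS lam i = \sum_i w i by rewrite -monw -iE.
by apply: minor_wt_ge sG => j; exact: (wP j).2.
Qed.

(** In the echelon basis at a lightest nonzero minor, every monomial of the
    product weighs at least as much as that minor. *)
Lemma wedge_wt_sum_wt (P : R -> Prop) lam G :
    (forall x y, x <= y -> P x -> P y) -> wedge G != 0 ->
    (forall s, ext_coef coef s G != 0 -> P (wtL lam s)) ->
  exists2 M : 'M[C]_m, \det M != 0 &
    forall i, hs_coef i (hs_sum (combine M G)) != 0 -> P (wtS lam i).
Proof.
move=> Pup G0 GP; have rep := hs_rep R n d.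
have [s0 s0G] : exists s, ext_coef coef s G != 0.
  apply: contrapT => /forallNP h; move/eqP: G0; apply.
  rewrite (wedge_span rep) big1// => s _.
  by have /negP := h s; rewrite negbK => /eqP ->; rewrite scale0r.
have [M [u [M0 uG uP]]] := echelon_basis (wr_phi_linear rep) (wtV lam) s0G.
exists M => // i iF.
have [s [sG sE]] := minor_sorted (wtV lam) uG.
have Pu : P (\sum_j wtV lam (u j)) by rewrite -sE -wt_ext; exact: GP.
apply: Pup Pu.
have : wt_ge lam (\prod_j val (combine M G j)) (\sum_j wtV lam (u j)).
  apply: wt_ge_prod => j mon monF.
  have [x xE] : exists x : hmon n d, hmon_exp x = mon.
    by apply: hmonP; exact: (dhomog_mf (dhomog_is_dhomog (combine M G j)) monF).
  by rewrite -xE; apply: uP; rewrite /hs_coef xE -mcoeff_msupp.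
by apply; rewrite mcoeff_msupp.
Qed.

Lemma hs_act_sum h G : hs_act h (hs_sum G) = hs_sum (fun i => hs_act h (G i)).
Proof. by apply/val_inj; exact: lin_subst_prod. Qed.

Lemma hs_act_combine h M G :
  (fun i => hs_act h (combine M G i)) = combine M (fun i => hs_act h (G i)).
Proof. by apply/funext => i; exact: linear_comb (hs_act_linear h). Qed.

End LinearSystems.

Section BasisChange.
Variables (R : realType) (V : vectType R[i]) (L : {vspace V}) (m : nat).
Local Notation C := R[i].
Implicit Types (X Y : m.-tuple V).

(** The coordinate matrix has a right inverse B, and by Cauchy-Binet det (A B)
    = 1 is a combination of the maximal minors of A. *)
Lemma wedge_neq0 (f : 'I_m -> V) :
  (forall c : 'rV[C]_m, \sum_i c 0 i *: f i = 0 -> c = 0) -> wedge f != 0.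
Proof.
move=> ff; pose A := \matrix_(i < m, j < \dim {:V}) coords (f i) 0 j.
have /row_freeP[B AB] : row_free A.
  apply: inj_row_free => c cA; apply: ff.
  rewrite [LHS]coordsP big1// => j _.
  have -> : coords (\sum_i c 0 i *: f i) 0 j = (c *m A) 0 j.
    rewrite [RHS]mxE (scalar_comb _ _ (@coords_scalar R V j)).
    by apply: eq_bigr => i _; rewrite [A _ _]mxE.
  by rewrite cA mxE scale0r.
apply/eqP => f0; have := cauchy_binet A B; rewrite AB det1 big1 => [/esym/eqP|s _].
  by rewrite eq_sym oner_eq0.
have -> : \det (colsub (tnth (val s)) A) = wedge f s.
  rewrite wedgeE; congr determinant.
  by apply/matrixP => i j; rewrite [LHS]mxE [RHS]mxE mxE.
by rewrite f0 ffunE mul0r.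
Qed.

Lemma basis_wedge_neq0 X : basis_of L X -> wedge (tnth X) != 0.
Proof.
move=> /basis_free/freeP Xf; apply: wedge_neq0 => c cX.
apply/rowP => i; rewrite mxE; apply: (Xf (fun i => c 0 i)).
by rewrite -[RHS]cX; apply: eq_bigr => j _; rewrite (tnth_nth 0).
Qed.

Lemma change_basis X Y : basis_of L X -> basis_of L Y ->
  exists M : 'M[C]_m, tnth X = combine M (tnth Y).
Proof.
move=> bX bY; exists (\matrix_(i, j) coord Y j (tnth X i)); apply/funext => i.
have XL : tnth X i \in <<Y>>%VS.
  by rewrite (span_basis bY); apply: (basis_mem bX); exact: mem_tnth.
rewrite {1}(coord_span XL) /combine; apply: eq_bigr => j _.
by rewrite mxE -tnth_nth.
Qed.

Lemma combine_basis X (M : 'M[C]_m) : basis_of L X -> \det M != 0 ->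
  basis_of L (mktuple (combine M (tnth X))).
Proof.
move=> bX M0; have Mu : M \in unitmx by rewrite unitmxE unitfE.
have dimL : \dim L = m by rewrite -(span_basis bX); move/basis_free: bX => /eqP ->; rewrite size_tuple.
rewrite basisEdim size_tuple dimL leqnn andbT.
rewrite -(span_basis bX); apply/span_subvP => v /tnthP[i ->].
have -> : tnth X i = combine (invmx M) (combine M (tnth X)) i.
  by rewrite combineM mulVmx// combine1.
apply: memv_suml => l _; apply: memvZ; apply: memv_span.
by rewrite -[X in X \in _](tnth_mktuple (combine M (tnth X)) l) mem_tnth.
Qed.

End BasisChange.

Section PluckerWeights.
Variables (R : realType) (n d k : nat).
Local Notation C := R[i].
Local Notation N := n.+1.
Local Notation m := k.+1.
Local Notation V := (dhomog N C d).
Variables (L : {vspace V}) (dimL : \dim L = m).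
Implicit Types (h : 'M[C]_N) (lam : 'rV[R]_N) (F : m.-tuple V).

Local Notation wtS := (wt (@hs_chi n (d * m))).
Local Notation wtL := (wt (ext_chi (@hs_chi n d) (m := m))).
Local Notation phiL := (ext_phi (@hs_coef R n d) (m := m)).

Definition canonical_basis : m.-tuple V := tcast dimL (vbasis L).
Local Notation X0 := canonical_basis.

Lemma canonical_basis_of : basis_of L X0.
Proof. by rewrite /canonical_basis val_tcast; exact: vbasisP. Qed.

Lemma pluckerE : plucker m L = wedge (tnth X0).
Proof.
by congr wedge; apply/funext => i; rewrite (tnth_nth 0) /canonical_basis val_tcast.
Qed.

Lemma plucker_neq0 : plucker m L != 0.
Proof. by rewrite pluckerE; exact: basis_wedge_neq0 canonical_basis_of. Qed.

Lemma hs_act_neq0 e h (f : dhomog N C e) : h \in unitmx -> f != 0 -> hs_act h f != 0.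
Proof. exact: act_neq0 (hs_rep R n e) h f. Qed.

Lemma hs_sum_neq0 F : basis_of L F -> hs_sum (tnth F) != 0.
Proof.
move=> /basis_free/free_not0 F0; apply/eqP => /(congr1 val)/= /eqP.
apply/negP/prodf_neq0 => i _.
have : tnth F i != 0 by have := F0 _ (mem_tnth i F).
by apply: contra => /eqP Fi; apply/eqP/val_inj.
Qed.

Lemma linsys_act_plucker h :
  linsys_act h (plucker m L) = wedge (fun i => hs_act h (tnth X0 i)).
Proof. by rewrite pluckerE; apply: ext_map_wedge; exact: hs_act_linear. Qed.

Lemma hs_act_basis_wedge_neq0 h : h \in unitmx ->
  wedge (fun i => hs_act h (tnth X0 i)) != 0.
Proof.
move=> hu; rewrite -linsys_act_plucker.
exact: (act_neq0 (ext_rep (hs_rep R n d) m) hu plucker_neq0).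
Qed.

(** A pair (h, lam) sees the same sign on L as on the most favourable basis of
    L. *)
Lemma plucker_weights (P : R -> Prop) h lam : h \in unitmx ->
    (forall x y, x <= y -> P x -> P y) ->
  (forall s, phiL s (linsys_act h (plucker m L)) != 0 -> P (wtL lam s)) <->
  (exists2 F : m.-tuple V, basis_of L F &
    forall i, hs_coef i (hs_act h (hs_sum (tnth F))) != 0 -> P (wtS lam i)).
Proof.
move=> hu Pup; have rep := hs_rep R n d.
rewrite linsys_act_plucker; split=> [LP|[F bF FP] s].
  have [|M M0 MP] := wedge_wt_sum_wt Pup (hs_act_basis_wedge_neq0 hu) (lam := lam).
    by move=> s; rewrite -(ext_phi_wedge rep); exact: LP.
  exists (mktuple (combine M (tnth X0))); first exact: combine_basis canonical_basis_of M0.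
  move=> i; rewrite hs_act_sum; move: i.
  have -> : (fun i => hs_act h (tnth (mktuple (combine M (tnth X0))) i)) =
      combine M (fun i => hs_act h (tnth X0 i)).
    rewrite -hs_act_combine; apply/funext => i; congr (hs_act h _).
    exact: tnth_mktuple.
  exact: MP.
rewrite (ext_phi_wedge rep).
have [M ME] := change_basis canonical_basis_of bF.
have -> : (fun i => hs_act h (tnth X0 i)) = combine M (fun i => hs_act h (tnth F i)).
  by rewrite -hs_act_combine -ME.
move=> sM; apply: (@sum_wt_wedge_wt _ _ _ _ P lam (fun i => hs_act h (tnth F i)) Pup).
- move=> i; apply: hs_act_neq0 => //.
  by have /free_not0 := basis_free bF; apply; exact: mem_tnth.
- by move=> i; rewrite -hs_act_sum; exact: FP.
move: sM; have := minor_combine (wr_phi_linear rep) (ext_idx s) M (fun i => hs_act h (tnth F i)).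
rewrite /minor -/(ext_coef _ _ _) => ->.
by rewrite mulf_eq0 negb_or => /andP[].
Qed.

End PluckerWeights.

Theorem theorem1p1 (R : realType) (n d k : nat)
    (L : {vspace dhomog n.+1 R[i] d}) (dimL : \dim L = k.+1) :
  (linsys_stable k L <->
     (forall F : k.+1.-tuple (dhomog n.+1 R[i] d),
        basis_of L F -> hs_stable (hs_sum (tnth F))))
  /\ (linsys_semistable k L <->
     (forall F : k.+1.-tuple (dhomog n.+1 R[i] d),
        basis_of L F -> hs_semistable (hs_sum (tnth F)))).
Proof.
have repL := ext_rep (hs_rep R n d) k.+1.
have repS := hs_rep R n (d * k.+1).
split.
  apply: (iff_trans (hilbert_mumford_stable repL (plucker_neq0 dimL))).
  split=> [nL F bF|FP [h [lam [h1 lam0 lams hP]]]].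
    apply/(hilbert_mumford_stable repS (hs_sum_neq0 bF)).
    move=> [h [lam [h1 lam0 lams hP]]]; apply: nL; exists h, lam; split => //.
    apply/(plucker_weights dimL (P := fun x => 0 <= x)).
    - exact: SL_unit.
    - by move=> x y xy x0; exact: le_trans xy.
    by exists F.
  have [||F bF Fh] := (plucker_weights dimL (P := fun x => 0 <= x) (h := h) lam _ _).1 hP.
  - exact: SL_unit.
  - by move=> x y xy x0; exact: le_trans xy.
  have /(hilbert_mumford_stable repS (hs_sum_neq0 bF)) := FP F bF.
  by apply; exists h, lam.
apply: (iff_trans (hilbert_mumford_semistable repL _)).
split=> [nL F bF|FP [h [lam [h1 lams hP]]]].
  apply/(hilbert_mumford_semistable repS).
  move=> [h [lam [h1 lams hP]]]; apply: nL; exists h, lam; split => //.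
  apply/(plucker_weights dimL (P := fun x => 0 < x)).
  - exact: SL_unit.
  - by move=> x y xy x0; exact: lt_le_trans xy.
  by exists F.
have [||F bF Fh] := (plucker_weights dimL (P := fun x => 0 < x) (h := h) lam _ _).1 hP.
- exact: SL_unit.
- by move=> x y xy x0; exact: lt_le_trans xy.
have /(hilbert_mumford_semistable repS) := FP F bF.
by apply; exists h, lam.
Qed.
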